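(* When $k\ge3$, the finite element space $\boldsymbol\Phi_h$ is $\boldsymbol H(\operatorname{curl}\operatorname{curl}^{\mathsf T};\mathbb S)$ conforming, i.e. $\boldsymbol\Phi_h\subset\boldsymbol H(\operatorname{curl}\operatorname{curl}^{\mathsf T},\Omega;\mathbb S)$.
   Context: Coordinates are $(x_1,x_2,x_3)=(x,y,z)$, $\partial_i=\partial/\partial x_i$. Whenever indices $i,j,l$ occur together they are pairwise distinct, i.e. $\{i,j,l\}=\{1,2,3\}$. $\mathcal Q(i{:}a,j{:}b,l{:}c)$ is the space of polynomials of degree at most $a$ in $x_i$, at most $b$ in $x_j$ and at most $c$ in $x_l$ (separately); similarly with fewer variables on faces and edges; it is the zero space if some bound is negative. $\mathbb S$ is the space of symmetric real $3\times3$ matrices. $\operatorname{curl}$ acts row-wise on matrix fields and $\operatorname{curl}^{\mathsf T}\boldsymbol\sigma=(\operatorname{curl}\boldsymbol\sigma^{\mathsf T})^{\mathsf T}$. $\boldsymbol H(\operatorname{curl}\operatorname{curl}^{\mathsf T},\Omega;\mathbb S)=\{\boldsymbol u\in L^2(\Omega;\mathbb S):\operatorname{curl}\operatorname{curl}^{\mathsf T}\boldsymbol u\in L^2(\Omega;\mathbb S)\}$. $\Omega\subset\mathbb R^3$ is a contractible domain with Lipschitz boundary, partitioned by a (face-to-face) mesh $\mathcal T_h$ of axis-parallel cuboids. $e_i$ denotes an edge parallel to the $x_i$-axis; $F_{ij}=F_{ji}$ denotes a face parallel to the $x_i$- and $x_j$-axes. A finite element space given by a shape function space on each cell $T$ and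 degrees of freedom (DOFs) on $T$ consists of all piecewise polynomial fields whose restriction to each cell is in the shape function space and such that each DOF attached to a vertex, edge or face has the same value from all cells containing that vertex, edge or face. ''Moments of $f$ on $G$ against $P$'' means the functionals $\int_G f\,p$ for all $p\in P$. $\boldsymbol\Phi_h$: shape functions: symmetric $\boldsymbol\sigma$ with $\sigma_{ii}\in\mathcal Q(i{:}k-1,j{:}k+1,l{:}k+1)$ and, for $i\ne j$, $\sigma_{ij}=\sigma_{ji}\in\mathcal Q(i{:}k,j{:}k,l{:}k+1)$. DOFs of $\sigma_{ii}$: moments of $\sigma_{ii},\partial_j\sigma_{ii},\partial_l\sigma_{ii},\partial_j\partial_l\sigma_{ii}$ on each $e_i$ against $\mathcal Q(i{:}k-1)$; for each $j\ne i$, moments of $\sigma_{ii},\partial_l\sigma_{ii}$ on each $F_{ij}$ against $\mathcal Q(i{:}k-1,j{:}k-3)$; moments of $\sigma_{ii}$ on $T$ against $\mathcal Q(i{:}k-1,j{:}k-3,l{:}k-3)$. DOFs of $\sigma_{ij}$ ($i<j$): $\sigma_{ij},\partial_l\sigma_{ij}$ at each vertex; moments of $\sigma_{ij},\partial_l\sigma_{ij}$ on each $e_i$ against $\mathcal Q(i{:}k-2)$ and on each $e_j$ against $\mathcal Q(j{:}k-2)$; moments of $\sigma_{ij}$ on each $e_l$ against $\mathcal Q(l{:}k-3)$; moments of $\sigma_{ij},\partial_l\sigma_{ij}$ on each $F_{ij}$ against $\mathcal Q(i{:}k-2,j{:}k-2)$; moments of $\sigma_{ij}$ on each $F_{il}$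 against $\mathcal Q(i{:}k-2,l{:}k-3)$ and on each $F_{jl}$ against $\mathcal Q(j{:}k-2,l{:}k-3)$; moments of $\sigma_{ij}$ on $T$ against $\mathcal Q(i{:}k-2,j{:}k-2,l{:}k-3)$. *)

(* Defs.v *)
From HB Require Import structures.
From mathcomp Require Import all_boot all_order all_algebra.
From mathcomp Require Import all_classical all_reals all_analysis.

Set Implicit Arguments.
Unset Strict Implicit.
Unset Printing Implicit Defensive.
Import Order.TTheory GRing.Theory Num.Theory.
Import numFieldNormedType.Exports.
Local Open Scope classical_set_scope.
Local Open Scope ring_scope.

Notation R3 R := (R * R * R)%type.
Notation leb R := (@lebesgue_measure R).
Notation leb2 R := (leb R \x leb R)%E.
Notation leb3 R := ((leb R \x leb R) \x leb R)%E.

Section Space.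
Variable R : realType.
Implicit Types (x v : R3 R) (i j l m : 'I_3) (f phi : R3 R -> R).

Definition crd x i : R :=
  match val i with 0%N => x.1.1 | 1%N => x.1.2 | _ => x.2 end.

Definition mk3 (c : 'I_3 -> R) : R3 R := (c 0, c 1, c 2).

Definition upd x i (t : R) : R3 R :=
  mk3 (fun m => if m == i then t else crd x m).

Definition basis_vec i : R3 R := mk3 (fun m => (m == i)%:R).

Definition partial i f : R3 R -> R := fun x => 'D_(basis_vec i) f x.

Definition partials (D : seq 'I_3) f : R3 R -> R := foldr partial f D.

(* C^infinity: every iterated partial derivative exists and is continuous. *)
Definition smooth f : Prop :=
  forall D : seq 'I_3, continuous (partials D f) /\
    forall i x, derivable (partials D f) x (basis_vec i).

(* The space D(Omega) of test functions, extended by zero to R^3. *)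
Definition test_function (Omega : set (R3 R)) phi : Prop :=
  [/\ smooth phi,
      compact (closure [set x | phi x != 0]) &
      closure [set x | phi x != 0] `<=` Omega].

End Space.

Section Domain.
Variable R : realType.
Implicit Type Omega : set (R3 R).

Definition domain Omega : Prop :=
  [/\ Omega !=set0, open Omega & connected Omega].

Definition contractible Omega : Prop :=
  exists (x0 : R3 R) (H : R * R3 R -> R3 R),
    [/\ Omega x0,
        {within `[0, 1] `*` Omega, continuous H},
        forall (t : R) x, t \in `[0, 1] -> Omega x -> Omega (H (t, x)),
        forall x, Omega x -> H (0, x) = x &
        forall x, Omega x -> H (1, x) = x0].

(* The point with coordinates y in the frame with origin x0 whose axes are the
   rows of O. *)
Definition in_frame (x0 : R3 R) (O : 'M[R]_3) (y : R3 R) : R3 R :=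
  mk3 (fun i => crd x0 i + \sum_m crd y m * O m i).

(* Near each boundary point, after a rigid motion, Omega is the strict epigraph
   of a Lipschitz function of two variables. *)
Definition lipschitz_boundary Omega : Prop :=
  forall x0 : R3 R, (closure Omega `\` interior Omega) x0 ->
  exists (O : 'M[R]_3) (L r h : R) (gamma : R * R -> R),
    [/\ O *m O^T = 1%:M, 0 < r, 0 < h, L.-lipschitz gamma &
        (forall y : R * R, `|y.1| < r -> `|y.2| < r -> `|gamma y| < h) /\
        (forall y : R3 R, `|y.1.1| < r -> `|y.1.2| < r -> `|y.2| < h ->
           Omega (in_frame x0 O y) <-> gamma y.1 < y.2)].

End Domain.

(* An axis-parallel box, possibly degenerate, given by its lower and upper
   corners. Cells are the boxes of positive side lengths; their faces, edges
   and vertices are boxes that are degenerate in one, two or three directions. *)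
Notation box R := (R3 R * R3 R)%type.

Section Mesh.
Variable R : realType.
Implicit Types (T E : box R) (i j l m : 'I_3).

Definition lo T i : R := crd T.1 i.
Definition hi T i : R := crd T.2 i.

Definition box_set T : set (R3 R) :=
  [set x | forall i, lo T i <= crd x i <= hi T i].

Definition box_inner T : set (R3 R) :=
  [set x | forall i, lo T i < crd x i < hi T i].

Definition cuboid T : Prop := forall i, lo T i < hi T i.

(* E is a vertex, an edge or a face of the cuboid T, or T itself. *)
Definition subentity E T : Prop :=
  forall i, lo E i = lo T i /\ hi E i = hi T i \/
            lo E i = hi E i /\ (lo E i = lo T i \/ lo E i = hi T i).

Definition cuboid_mesh (Omega : set (R3 R)) (Th : seq (box R)) : Prop :=
  [/\ {in Th, forall T, cuboid T},
      closure Omega = \bigcup_(T in [set` Th]) box_set T,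
      {in Th &, forall T T', T != T' -> box_inner T `&` box_inner T' = set0} &
      {in Th &, forall T T', box_set T `&` box_set T' = set0 \/
         exists E, [/\ subentity E T, subentity E T' &
                       box_set T `&` box_set T' = box_set E]}].

Definition is_vertex E : Prop := forall m, lo E m = hi E m.

(* E is parallel to exactly the axes x_m with m in D. *)
Definition parallel (D : seq 'I_3) E : Prop :=
  forall m, (m \in D -> lo E m < hi E m) /\ (m \notin D -> lo E m = hi E m).

Definition edge_along i E : Prop := parallel [:: i] E.
Definition face_along i j E : Prop := parallel [:: i; j] E.

Definition int_edge i E (f : R3 R -> R) : R :=
  \int[leb R]_(t in `[lo E i, hi E i]) f (upd E.1 i t).

Definition int_face i j E (f : R3 R -> R) : R :=
  \int[leb2 R]_(t in `[lo E i, hi E i] `*` `[lo E j, hi E j])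
    f (upd (upd E.1 i t.1) j t.2).

Definition int_cell E (f : R3 R -> R) : R := \int[leb3 R]_(x in box_set E) f x.

End Mesh.

Section FiniteElement.
Variable R : realType.
Implicit Types (E T : box R) (i j l m : 'I_3) (q : R3 R -> R).
Implicit Type s : R3 R -> 'M[R]_3.

(* Polynomial functions of degree at most b i in x_i for each i. The bounds are
   integers, so that the space is zero as soon as one of them is negative. *)
Definition Qspace (b : 'I_3 -> int) : set (R3 R -> R) :=
  [set f | exists (N : nat) (c : {ffun 'I_3 -> 'I_N} -> R),
     (forall e, c e != 0 -> forall i, (e i : nat)%:Z <= b i) /\
     forall x, f x = \sum_e c e * \prod_i crd x i ^+ e i].

Definition Q3 i (a : int) j (b : int) l (c : int) : set (R3 R -> R) :=
  Qspace (fun m => if m == i then a else if m == j then b else c).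

(* Polynomials on a face parallel to x_i, x_j, resp. on an edge parallel to x_i,
   are seen as functions on R^3 not depending on the other coordinates. *)
Definition Q2 i (a : int) j (b : int) : set (R3 R -> R) :=
  Qspace (fun m => if m == i then a else if m == j then b else 0).
Definition Q1 i (a : int) : set (R3 R -> R) :=
  Qspace (fun m => if m == i then a else 0).

Definition entry s i j : R3 R -> R := fun x => s x i j.

Definition distinct3 i j l : bool := uniq [:: i; j; l].

Definition Phi_shape (k : nat) s : Prop :=
  [/\ forall x i j, s x i j = s x j i,
      forall i j l, distinct3 i j l ->
        Q3 i (k%:Z - 1) j (k%:Z + 1) l (k%:Z + 1) (entry s i i) &
      forall i j l, distinct3 i j l ->
        Q3 i k%:Z j k%:Z l (k%:Z + 1) (entry s i j)].

(* Phi_dof k E L: the functional L is one of the degrees of freedom attached to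
   the vertex, edge, face or cell E. The list D of directions stands for the
   iterated partial derivative being tested. *)
Inductive Phi_dof (k : nat) : box R -> ((R3 R -> 'M[R]_3) -> R) -> Prop :=
| Dof_diag_edge E i j l D q :
    distinct3 i j l -> edge_along i E ->
    D \in [:: [::]; [:: j]; [:: l]; [:: j; l]] ->
    Q1 i (k%:Z - 1) q ->
    Phi_dof k E (fun s =>
      int_edge i E (fun x => partials D (entry s i i) x * q x))
| Dof_diag_face E i j l D q :
    distinct3 i j l -> face_along i j E ->
    D \in [:: [::]; [:: l]] ->
    Q2 i (k%:Z - 1) j (k%:Z - 3) q ->
    Phi_dof k E (fun s =>
      int_face i j E (fun x => partials D (entry s i i) x * q x))
| Dof_diag_cell E i j l q :
    distinct3 i j l -> cuboid E ->
    Q3 i (k%:Z - 1) j (k%:Z - 3) l (k%:Z - 3) q ->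
    Phi_dof k E (fun s => int_cell E (fun x => entry s i i x * q x))
| Dof_off_vertex E i j l D :
    distinct3 i j l -> (i < j)%N -> is_vertex E ->
    D \in [:: [::]; [:: l]] ->
    Phi_dof k E (fun s => partials D (entry s i j) E.1)
| Dof_off_edge E i j l m D q :
    distinct3 i j l -> (i < j)%N -> m \in [:: i; j] -> edge_along m E ->
    D \in [:: [::]; [:: l]] ->
    Q1 m (k%:Z - 2) q ->
    Phi_dof k E (fun s =>
      int_edge m E (fun x => partials D (entry s i j) x * q x))
| Dof_off_edge_normal E i j l q :
    distinct3 i j l -> (i < j)%N -> edge_along l E ->
    Q1 l (k%:Z - 3) q ->
    Phi_dof k E (fun s => int_edge l E (fun x => entry s i j x * q x))
| Dof_off_face E i j l D q :
    distinct3 i j l -> (i < j)%N -> face_along i j E ->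
    D \in [:: [::]; [:: l]] ->
    Q2 i (k%:Z - 2) j (k%:Z - 2) q ->
    Phi_dof k E (fun s =>
      int_face i j E (fun x => partials D (entry s i j) x * q x))
| Dof_off_face_normal E i j l m q :
    distinct3 i j l -> (i < j)%N -> m \in [:: i; j] -> face_along m l E ->
    Q2 m (k%:Z - 2) l (k%:Z - 3) q ->
    Phi_dof k E (fun s => int_face m l E (fun x => entry s i j x * q x))
| Dof_off_cell E i j l q :
    distinct3 i j l -> (i < j)%N -> cuboid E ->
    Q3 i (k%:Z - 2) j (k%:Z - 2) l (k%:Z - 3) q ->
    Phi_dof k E (fun s => int_cell E (fun x => entry s i j x * q x)).

(* Fields are taken up to null sets: u is a (Borel) representative, and p T is
   its polynomial on the cell T. For a cell E the matching condition is void,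
   since E is then a subentity of no other cell. *)
Definition Phi_space (k : nat) (Omega : set (R3 R)) (Th : seq (box R)) :
    set (R3 R -> 'M[R]_3) :=
  [set u | (forall i j, measurable_fun Omega (entry u i j)) /\
     exists p : box R -> R3 R -> 'M[R]_3,
     [/\ {in Th, forall T, Phi_shape k (p T)},
         {in Th, forall T, {ae leb3 R, forall x, box_set T x -> u x = p T x}} &
         forall E dof, Phi_dof k E dof ->
           {in Th &, forall T T', subentity E T -> subentity E T' ->
              dof (p T) = dof (p T')}]].

End FiniteElement.

Section CurlCurl.
Variable R : realType.
Implicit Types (Omega : set (R3 R)) (f : R3 R -> R) (u : R3 R -> 'M[R]_3).

Definition distribution : Type := (R3 R -> R) -> R.
Implicit Type S : 'M[distribution]_3.

Definition ddistr (i : 'I_3) (t : distribution) : distribution :=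
  fun phi => - t (partial i phi).

(* Row-wise curl; indices are taken modulo 3. *)
Definition curl S : 'M[distribution]_3 :=
  \matrix_(m, i) (fun phi => ddistr (i + 1) (S m (i + 2)) phi
                           - ddistr (i + 2) (S m (i + 1)) phi).

Definition curlT S : 'M[distribution]_3 := (curl S^T)^T.

Definition regular_distr Omega f : distribution :=
  fun phi => \int[leb3 R]_(x in Omega) (f x * phi x).

Definition regular_mx Omega u : 'M[distribution]_3 :=
  \matrix_(i, j) regular_distr Omega (entry u i j).

Definition L2 Omega : set (R3 R -> R) :=
  [set f : R3 R -> R | measurable_fun Omega f /\
           (leb3 R).-integrable Omega (fun x => (f x ^+ 2)%:E)].

Definition L2_mx Omega : set (R3 R -> 'M[R]_3) :=
  [set u | forall i j, L2 Omega (entry u i j)].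

Definition L2_sym Omega : set (R3 R -> 'M[R]_3) :=
  [set u | L2_mx Omega u /\
           {ae leb3 R, forall x, Omega x -> (u x)^T = u x}].

(* H(curl curl^T, Omega; S), with curl curl^T in the sense of distributions. *)
Definition Hcurlcurl Omega : set (R3 R -> 'M[R]_3) :=
  [set u | L2_sym Omega u /\
     exists2 w, L2_mx Omega w &
       forall i j phi, test_function Omega phi ->
         curl (curlT (regular_mx Omega u)) i j phi =
         regular_mx Omega w i j phi].

End CurlCurl.

(* Main.v *)
Require Import Defs.
From HB Require Import structures.
From mathcomp Require Import all_boot all_order all_algebra.
From mathcomp Require Import all_classical all_reals all_analysis.
From mathcomp Require Import ring lra zify measurable_realfun.

(** On a cell every entry of the field is a finite sum of products of
    one-variable polynomials. The degrees of freedom attached to a face, its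
    edges and its vertices are tensor products of one-variable functionals that
    determine polynomials of the relevant degree (moments; end values and
    moments; end values, end slopes and moments). Hence two cells sharing a face
    with normal x_c have the same entry u_ab on its plane unless a = b = c, and
    the same normal derivative of u_ab unless c is a or b. These are exactly the
    continuity properties needed for the second derivatives d_p d_q u_ab with
    p <> b and q <> a that occur in curl curl^T to have no jump term.

    Integration by parts is done line by line: on a line parallel to an axis the
    boundary terms of consecutive cells cancel, or vanish with the test function.
    Since cells are replaced by their interiors, every such line leaves a cell
    through the relative interior of a face, where at most two cells meet. *)

Set Implicit Arguments.
Unset Strict Implicit.
Unset Printing Implicit Defensive.
Import Order.TTheory GRing.Theory Num.Theory.
Import numFieldTopology.Exports numFieldNormedType.Exports.
Local Open Scope classical_set_scope.
Local Open Scope ring_scope.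

(** * Coordinates and directional derivatives *)

(** The integration by parts in x_q comes first: it needs only that u_ab has no jump across faces
    with normal x_q, which q <> a ensures. The one in x_p then meets d_q u_ab. If p <> q, this
    derivative is tangential to the faces with normal x_p, so continuity of u_ab there is enough,
    and p <> b gives it. If p = q, it is the normal derivative, and then p differs from both a and
    b. The one-variable counts behind the continuity are exact. Degree k+1 is matched by two end
    values, two end slopes and k-2 moments; degree k by two end values and k-1 moments; degree k-1
    by k moments. A derivative normal to the face does not change the degrees in the face variables,
    so one argument serves the entry and its normal derivative. Fubini and additivity of the
    integral require integrability at every use. All integrands on the whole space are therefore
    kept in one class of bounded measurable functions vanishing outside a cube, and the test
    function allows passing between integrals over [Omega] and over the whole space. *)

Section Coordinates.
Variable R : realType.
Implicit Types (x y : R3 R) (i j a m : 'I_3) (f g : R3 R -> R) (t : R).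

Lemma ord3P (P : 'I_3 -> Prop) : P 0 -> P 1 -> P 2 -> forall i, P i.
Proof.
move=> P0 P1 P2 [[|[|[|//]]] i3].
- by rewrite (_ : Ordinal _ = 0)//; exact: val_inj.
- by rewrite (_ : Ordinal _ = 1)//; exact: val_inj.
- by rewrite (_ : Ordinal _ = 2)//; exact: val_inj.
Qed.

Lemma crd_mk3 (c : 'I_3 -> R) i : crd (mk3 c) i = c i.
Proof. by elim/ord3P: i. Qed.

Lemma R3_ext x y : (forall m, crd x m = crd y m) -> x = y.
Proof.
case: x y => [[x0 x1] x2] [[y0 y1] y2] e.
by move: (e 0) (e 1) (e 2); rewrite /crd /= => -> -> ->.
Qed.

Lemma crd_upd x a t m : crd (upd x a t) m = if m == a then t else crd x m.
Proof. exact: crd_mk3. Qed.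

Lemma upd_crd x a : upd x a (crd x a) = x.
Proof. by apply: R3_ext => m; rewrite crd_upd; case: eqP => [->|]. Qed.

Lemma upd_upd x a s t : upd (upd x a s) a t = upd x a t.
Proof. by apply: R3_ext => m; rewrite !crd_upd; case: eqP. Qed.

Lemma crdD x y m : crd (x + y) m = crd x m + crd y m.
Proof. by elim/ord3P: m. Qed.

Lemma crdZ t x m : crd (t *: x) m = t * crd x m.
Proof. by elim/ord3P: m. Qed.

Lemma shift_basis_vec t x a : t *: basis_vec R a + x = upd x a (t + crd x a).
Proof.
apply: R3_ext => m; rewrite crdD crdZ crd_upd crd_mk3.
by case: eqP => [->|_]; rewrite ?mulr1 ?mulr0 ?add0r.
Qed.

(** Stated for difference quotients, so that derivability and the value of the derivative both pass
    to the restriction to a line by rewriting. *)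
Lemma partial_line f x a :
  (fun h : R => h^-1 *: (f (h *: basis_vec R a + x) - f x)) =
  (fun h : R => h^-1 *: (f (upd x a (h *: 1 + crd x a)) - f (upd x a (crd x a)))).
Proof.
by apply/funext => h /=; rewrite upd_crd -shift_basis_vec /GRing.scale /= mulr1.
Qed.

Lemma derivable_upd f x a :
  derivable f x (basis_vec R a) <->
  derivable (fun t => f (upd x a t)) (crd x a) 1.
Proof. by rewrite /derivable partial_line. Qed.

Lemma partial_derive1 f x a :
  partial a f x = derive1 (fun t => f (upd x a t)) (crd x a).
Proof. by rewrite derive1E /partial /derive partial_line. Qed.

Lemma partial_upd f x a t :
  partial a f (upd x a t) = derive1 (fun s => f (upd x a s)) t.
Proof.
rewrite partial_derive1 crd_upd eqxx.
by under eq_fun do rewrite upd_upd.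
Qed.

Lemma crd_continuous m : continuous (fun x : R3 R => crd x m).
Proof.
elim/ord3P: m => x /=; rewrite /crd /=; last exact: cvg_snd.
- apply: (@continuous_comp _ _ _ (@fst (R * R)%type R) (@fst R R)).
    exact: cvg_fst.
  exact: cvg_fst.
- apply: (@continuous_comp _ _ _ (@fst (R * R)%type R) (@snd R R)).
    exact: cvg_fst.
  exact: cvg_snd.
Qed.

Lemma mk3_continuous (T : topologicalType) (c : 'I_3 -> T -> R) :
  (forall m, continuous (c m)) -> continuous (fun s : T => mk3 (fun m => c m s)).
Proof.
by move=> cc t; exact: (cvg_pair (cvg_pair (cc 0 t) (cc 1 t)) (cc 2 t)).
Qed.

Lemma upd_continuous x a : continuous (upd x a).
Proof.
apply: mk3_continuous => m; case: eqP => _; first by move=> ?; exact: cvg_id.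
exact: cst_continuous.
Qed.

(** Regularity in a single direction: what the product rule and the fundamental theorem of calculus
    on lines parallel to the x_a-axis require. *)
Definition C1_along a f :=
  [/\ continuous f, forall x, derivable f x (basis_vec R a) &
      continuous (partial a f)].

Lemma smooth_partial f a : smooth f -> smooth (partial a f).
Proof.
move=> sf D; have := sf (rcons D a).
by rewrite /partials foldr_rcons.
Qed.

Lemma smooth_continuous f : smooth f -> continuous f.
Proof. by move=> /(_ [::]) []. Qed.

Lemma smooth_C1 f a : smooth f -> C1_along a f.
Proof.
by move=> sf; have [cf df] := sf [::]; have [cf' _] := sf [:: a]; split.
Qed.

Lemma partialM f g a : (forall x, derivable f x (basis_vec R a)) ->
    (forall x, derivable g x (basis_vec R a)) ->
  partial a (f \* g) = (f \* partial a g) \+ (partial a f \* g).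
Proof.
move=> df dg; apply/funext => x; rewrite /partial.
rewrite (_ : f \* g = f * g)// deriveM//=.
by congr (_ + _); rewrite mulrC.
Qed.

Lemma C1_alongM a f g : C1_along a f -> C1_along a g -> C1_along a (f \* g).
Proof.
move=> [cf df cf'] [cg dg cg']; split.
- by move=> x; apply: cvgM; [exact: cf|exact: cg].
- by move=> x; apply: derivableM.
- rewrite partialM// => x; apply: cvgD; apply: cvgM;
    [exact: cf|exact: cg'|exact: cf'|exact: cg].
Qed.

Lemma FTC_along a f x (l h : R) : C1_along a f -> l < h ->
  (\int[leb R]_(t in `]l, h[) (partial a f (upd x a t))%:E =
   (f (upd x a h) - f (upd x a l))%:E)%E.
Proof.
move=> [cf df cf'] lh.
have cF : continuous (fun t => f (upd x a t)).
  by move=> t; apply: continuous_comp; [exact: upd_continuous|exact: cf].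
have cF' : continuous (fun t => partial a f (upd x a t)).
  by move=> t; apply: continuous_comp; [exact: upd_continuous|exact: cf'].
have mF' : measurable_fun setT (fun t : R => (partial a f (upd x a t))%:E).
  by apply/measurable_EFinP; exact: continuous_measurable_fun.
have mS (D : set R) : measurable D ->
    measurable_fun D (fun t : R => (partial a f (upd x a t))%:E).
  by move=> mD; apply: measurable_funTS.
(* The interior of a cell cuts a line in an open interval; adding the two end points, a null set,
   gives the closed interval of the fundamental theorem. *)
rewrite integral_itv_bndo_bndc; last exact: mS.
rewrite integral_itv_obnd_cbnd; last exact: mS.
rewrite (@continuous_FTC2 _ _ (fun t => f (upd x a t)))//.
- by apply: continuous_subspaceT.
- split.
  + move=> t _; have /derivable_upd := df (upd x a t).
    rewrite crd_upd eqxx.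
    by under [X in derivable X]eq_fun do rewrite upd_upd.
  + by apply: cvg_at_right_filter; exact: cF.
  + by apply: cvg_at_left_filter; exact: cF.
- by move=> t _; rewrite /= partial_upd.
Qed.

End Coordinates.

(** * Measurability and Fubini in space *)

Section Measure.
Variable R : realType.
Implicit Types (x y : R3 R) (i j a m : 'I_3) (f g : R3 R -> R) (t : R).
Implicit Types (T E : box R).

Lemma all_ord3 (P : 'I_3 -> Prop) : (forall i, P i) <-> [/\ P 0, P 1 & P 2].
Proof.
split=> [Pi|[P0 P1 P2]]; first by split; exact: Pi.
exact: ord3P.
Qed.

Lemma box_setE T : box_set T =
  (`[lo T 0, hi T 0] `*` `[lo T 1, hi T 1]) `*` `[lo T 2, hi T 2].
Proof.
apply/seteqP; split=> [x /all_ord3[x0 x1 x2]|x [[/= x0 x1] x2]].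
  by split; [split|]; rewrite /= in_itv.
by apply/all_ord3; split; move: x0 x1 x2; rewrite !in_itv.
Qed.

Lemma box_innerE T : box_inner T =
  (`]lo T 0, hi T 0[ `*` `]lo T 1, hi T 1[) `*` `]lo T 2, hi T 2[.
Proof.
apply/seteqP; split=> [x /all_ord3[x0 x1 x2]|x [[/= x0 x1] x2]].
  by split; [split|]; rewrite /= in_itv.
by apply/all_ord3; split; move: x0 x1 x2; rewrite !in_itv.
Qed.

Lemma measurable_box_inner T : measurable (box_inner T).
Proof. by rewrite box_innerE; do 2 apply: measurableX => //. Qed.

Lemma box_inner_sub T : box_inner T `<=` box_set T.
Proof. by move=> x xT m; have /andP[? ?] := xT m; rewrite !ltW. Qed.

Lemma ball_crd x y (e : R) :
  (forall m, `|crd x m - crd y m| < e) -> ball x e y.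
Proof. by move=> /all_ord3[? ? ?]; split; [split|]. Qed.

(** Measurability refers to the product sigma-algebra; an open set belongs to it as the union of the
    countably many rational boxes that it contains. *)
Lemma open_measurable3 (U : set (R3 R)) : open U -> measurable U.
Proof.
move=> oU.
pose B (q : (rat * rat * rat) * (rat * rat * rat)) : box R :=
  ((ratr q.1.1.1, ratr q.1.1.2, ratr q.1.2),
   (ratr q.2.1.1, ratr q.2.1.2, ratr q.2.2)).
rewrite (_ : U = \bigcup_q
    if `[< box_inner (B q) `<=` U >] then box_inner (B q) else set0).
  apply: countable_bigcupT_measurable; first exact: countableP.
  by move=> q; case: ifP => // _; exact: measurable_box_inner.
apply/seteqP; split=> [x Ux|x [q _]]; last by case: asboolP => // BU /BU.
have /nbhs_ballP[e /= e0 xe] : nbhs x U by exact: open_nbhs_nbhs.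
have lq (c : R) : exists q : rat, c - e < ratr q < c.
  by have [|q] := @rat_in_itvoo R (c - e) c; [lra|rewrite in_itv; exists q].
have rq (c : R) : exists q : rat, c < ratr q < c + e.
  by have [|q] := @rat_in_itvoo R c (c + e); [lra|rewrite in_itv; exists q].
have [l0 hl0] := lq (crd x 0); have [l1 hl1] := lq (crd x 1).
have [l2 hl2] := lq (crd x 2); have [r0 hr0] := rq (crd x 0).
have [r1 hr1] := rq (crd x 1); have [r2 hr2] := rq (crd x 2).
exists (l0, l1, l2, (r0, r1, r2)) => //; case: asboolP => [_|].
  by apply/all_ord3; rewrite /lo /hi /B /= -!/(crd _ _); split; rewrite /crd/=;
    move: hl0 hl1 hl2 hr0 hr1 hr2; rewrite /crd /=; lra.
case=> y /all_ord3; rewrite /lo /hi /B /= => -[y0 y1 y2].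
apply: xe; apply: ball_crd; apply/all_ord3.
move: y0 y1 y2; rewrite {1 3 4 6 7 9}/crd /= => y0 y1 y2.
by split; rewrite ltr_norml; lra.
Qed.

Lemma continuous_measurable3 f : continuous f -> measurable_fun setT f.
Proof.
move=> /continuousP cf _.
apply: (measurability _ (RGenOpens.measurableE R)); last exact: measurableT.
move=> _ [_ [a [b ->]] <-]; rewrite setTI; apply: open_measurable3.
by apply: cf; exact: interval_open.
Qed.

Lemma integrable_supp d (X : measurableType d)
    (mu : {measure set X -> \bar R}) (D : set X) (h : X -> R) (M : R) :
  measurable D -> (mu D < +oo)%E -> measurable_fun setT h ->
  (forall s, `|h s| <= M) -> (forall s, ~ D s -> h s = 0) ->
  mu.-integrable setT (EFin \o h).
Proof.
move=> mD muD mh hM h0.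
rewrite (_ : EFin \o h = (EFin \o h) \_ D).
  apply/(integrable_mkcond _ mD); apply: measurable_bounded_integrable => //.
    exact: measurable_funTS.
  by exists M; split; [exact: num_real|move=> N /ltW MN x _; exact: le_trans MN].
apply/funext => x; rewrite /patch; case: ifPn => // /negP xD /=.
by rewrite h0// => Dx; apply: xD; rewrite inE.
Qed.

Definition cube2 (N : R) : set (R * R) := `[-N, N] `*` `[-N, N].
Definition cube3 (N : R) : set (R3 R) := (`[-N, N] `*` `[-N, N]) `*` `[-N, N].

Lemma cube2_fin N : (leb2 R (cube2 N) < +oo)%E.
Proof.
rewrite product_measure1E// lte_mul_pinfty//= ?ge0_fin_numE//;
  by rewrite lebesgue_measure_itv; case: ifP => _; rewrite ?ltry.
Qed.

Lemma cube3_fin N : (leb3 R (cube3 N) < +oo)%E.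
Proof.
rewrite product_measure1E//; last exact: measurableX.
rewrite lte_mul_pinfty//= ?ge0_fin_numE//; first exact: cube2_fin.
by rewrite lebesgue_measure_itv; case: ifP => _; rewrite ?ltry.
Qed.

(* The library's sigma-finite instance is only inferred for products of
   subprobabilities, so the one of the plane is declared on an alias. *)
Definition plane_measure := leb2 R.
HB.instance Definition _ := Measure.on plane_measure.

Lemma plane_measure_sigma_finite : sigma_finite setT plane_measure.
Proof.
exists (fun n : nat => cube2 n%:R); last first.
  by move=> n; split; [exact: measurableX|exact: cube2_fin].
apply/esym; rewrite -subTset => -[s t] _.
exists (Num.bound (`|s| + `|t|)) => //; rewrite /cube2 /= !in_itv /= -!ler_norml.
have := archi_boundP (addr_ge0 (normr_ge0 s) (normr_ge0 t)).
by move=> st; split; apply/ltW/(le_lt_trans _ st); rewrite ?lerDl ?lerDr.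
Qed.

HB.instance Definition _ := Measure_isSigmaFinite.Build _ _ _ plane_measure
  plane_measure_sigma_finite.

Lemma integral2_zero (h : R * R -> R) (N M : R) : measurable_fun setT h ->
  (forall w, `|h w| <= M) -> (forall w, ~ cube2 N w -> h w = 0) ->
  (forall s, \int[leb R]_t (h (s, t))%:E = 0)%E \/
  (forall t, \int[leb R]_s (h (s, t))%:E = 0)%E ->
  (\int[leb2 R]_w (h w)%:E = 0)%E.
Proof.
move=> mh hM h0 H.
have ih : (leb2 R).-integrable setT (EFin \o h).
  by apply: (integrable_supp _ (cube2_fin N)) hM h0 => //; exact: measurableX.
case: H => H.
  by rewrite -(integral12_prod_meas1 ih); apply: integral0_eq => s _; exact: H.
by rewrite -(integral21_prod_meas1 ih); apply: integral0_eq => s _; exact: H.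
Qed.

(** Fubini with x_a innermost. The product structure of the measure gives this directly for the last
    coordinate; for the others, each horizontal slice is treated by [integral2_zero]. The zeros in
    the base points are overwritten by the variable of integration. *)
Lemma integral3_zero a f (N M : R) : measurable_fun setT f ->
  (forall x, `|f x| <= M) -> (forall x, ~ cube3 N x -> f x = 0) ->
  (forall x, \int[leb R]_t (f (upd x a t))%:E = 0)%E ->
  (\int[leb3 R]_x (f x)%:E = 0)%E.
Proof.
move=> mf fM f0 H.
have if3 : (leb3 R).-integrable setT (EFin \o f).
  apply: (integrable_supp _ (cube3_fin N)) fM f0 => //.
  by apply: measurableX => //; exact: measurableX.
have fub12 := @integral12_prod_meas1 _ _ _ _ R plane_measure (leb R) _ if3.
have fub21 := @integral21_prod_meas1 _ _ _ _ R plane_measure (leb R) _ if3.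
elim/ord3P: a H => H; last first.
- apply: (etrans (esym fub12)).
  apply: integral0_eq => -[x y] _.
  exact: (H (x, y, 0)).
- apply: (etrans (esym fub21)).
  apply: integral0_eq => z _.
  apply: (integral2_zero (N := N) (M := M)) => //.
  + exact: (measurable_fun_pair1 z mf).
  + by move=> w wN; apply: f0 => -[].
  + by left=> s; exact: (H (s, 0, z)).
- apply: (etrans (esym fub21)).
  apply: integral0_eq => z _.
  apply: (integral2_zero (N := N) (M := M)) => //.
  + exact: (measurable_fun_pair1 z mf).
  + by move=> w wN; apply: f0 => -[].
  + by right=> s; exact: (H (0, s, z)).
Qed.

End Measure.

(** * Integration by parts on the mesh *)

Section Tame.
Variable R : realType.
Implicit Types (x y : R3 R) (i j a m : 'I_3) (f g : R3 R -> R) (t : R).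
Implicit Types (T E : box R).

(** A class stable under sums and products whose members are all integrable, so that additivity of
    the integral is always at hand. *)
Definition tame f := measurable_fun setT f /\
  exists N M : R, (forall x, `|f x| <= M) /\ forall x, ~ cube3 N x -> f x = 0.

Lemma cube3_le (N N' : R) : N <= N' -> cube3 N `<=` cube3 N'.
Proof.
move=> NN' [[x y] z] [[/=]]; rewrite !in_itv /= => x0 y0 z0.
by split; [split|]; rewrite /= in_itv /=; lra.
Qed.

Lemma tame0 : tame (fun=> 0).
Proof.
split; first exact: measurable_cst.
by exists 0, 0; split=> // x; rewrite normr0.
Qed.

Lemma tameD f g : tame f -> tame g -> tame (fun x => f x + g x).
Proof.
move=> [mf [N [M [fM f0]]]] [mg [N' [M' [gM g0]]]]; split.
  exact: measurable_funD.
exists (Num.max N N'), (M + M'); split=> [x|x xN].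
  by rewrite (le_trans (ler_normD _ _))// lerD.
rewrite f0 ?g0 ?addr0// => xN'; apply: xN; apply: cube3_le xN';
  by rewrite le_max lexx ?orbT.
Qed.

Lemma tame_sum (I : Type) (s : seq I) (F : I -> R3 R -> R) :
  (forall n, tame (F n)) -> tame (fun x => \sum_(n <- s) F n x).
Proof.
move=> tF; elim: s => [|i s ih].
  by under eq_fun do rewrite big_nil; exact: tame0.
by under eq_fun do rewrite big_cons; exact: tameD.
Qed.

Lemma tameM f g : tame f -> tame g -> tame (fun x => f x * g x).
Proof.
move=> [mf [N [M [fM f0]]]] [mg [N' [M' [gM g0]]]]; split.
  exact: measurable_funM.
exists N, (M * M'); split=> [x|x /f0 ->]; last by rewrite mul0r.
by rewrite normrM ler_pM.
Qed.

Lemma tameN f : tame f -> tame (fun x => - f x).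
Proof.
move=> [mf [N [M [fM f0]]]]; split; first exact: measurable_funN.
by exists N, M; split=> [x|x /f0 ->]; rewrite ?normrN// oppr0.
Qed.

Lemma tameB f g : tame f -> tame g -> tame (fun x => f x - g x).
Proof. by move=> tf /tameN; exact: tameD. Qed.

Lemma box_set_cube T : exists N, box_set T `<=` cube3 N.
Proof.
exists (\sum_i (`|lo T i| + `|hi T i|)) => x xT.
have Hm m : `|crd x m| <= \sum_i (`|lo T i| + `|hi T i|).
  rewrite (bigD1 m)//= ler_wpDr//; first by apply: sumr_ge0 => i _; rewrite addr_ge0.
  have := xT m; have := ler_norm (hi T m); have := ler_norm (- lo T m).
  rewrite normrN ler_norml; have := normr_ge0 (hi T m).
  by have := normr_ge0 (lo T m); lra.
by split; [split|]; rewrite /= in_itv /= -ler_norml;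
  [exact: (Hm 0)|exact: (Hm 1)|exact: (Hm 2)].
Qed.

Lemma compact_box_set T : compact (box_set T).
Proof.
by rewrite box_setE; do 2 (apply: compact_setX; last exact: segment_compact);
  exact: segment_compact.
Qed.

Lemma continuous_box_bounded T f : continuous f ->
  exists M, forall x, box_set T x -> `|f x| <= M.
Proof.
move=> cf; have cb := continuous_compact (continuous_subspaceT cf) (@compact_box_set T).
have [M [_ MP]] := compact_bounded cb.
(* [compact_bounded] gives as bounds the numbers strictly above [M]. *)
exists (M + 1) => x xT; apply: MP; first by rewrite ltrDl.
by exists x.
Qed.

Lemma tame_indic T f : continuous f -> tame (fun x => \1_(box_inner T) x * f x).
Proof.
move=> cf; split.
  apply: measurable_funM; last exact: continuous_measurable3.
  by apply: measurable_indic; exact: measurable_box_inner.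
have [N TN] := box_set_cube T; have [M fM] := continuous_box_bounded T cf.
exists N, `|M|; split=> x; rewrite indicE.
  case: (boolP (x \in _)) => [|_]; rewrite ?mul0r ?normr0// inE => xT.
  rewrite mul1r (le_trans (fM _ (box_inner_sub xT)))//; exact: ler_norm.
move=> xN; rewrite memNset ?mul0r// => xT; apply: xN; apply: TN.
exact: box_inner_sub.
Qed.

Lemma tame_integrable f : tame f -> (leb3 R).-integrable setT (EFin \o f).
Proof.
move=> [mf [N [M [fM f0]]]].
apply: (integrable_supp _ (cube3_fin N)) fM f0 => //.
by apply: measurableX => //; exact: measurableX.
Qed.

Lemma Rintegral_tameB f g : tame f -> tame g ->
  \int[leb3 R]_x (f x - g x) = \int[leb3 R]_x f x - \int[leb3 R]_x g x.
Proof. by move=> tf tg; rewrite RintegralB//; exact: tame_integrable. Qed.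

End Tame.

(** * Cancellation of end-point terms along a line *)

Section Telescoping.
Variable R : realType.

(** The nonzero terms of both sums are the same up to order. Zero terms are dropped, so an end where
    the integrand vanishes needs no partner. *)
Lemma sum_endpoints (I : eqType) (s : seq I) (l h F G : I -> R) : uniq s ->
  {in s &, injective l} -> {in s &, injective h} ->
  {in s, forall T, F T != 0 -> exists2 T', T' \in s & l T' = h T /\ G T' = F T} ->
  {in s, forall T, G T != 0 -> exists2 T', T' \in s & h T' = l T /\ F T' = G T} ->
  \sum_(T <- s) F T = \sum_(T <- s) G T.
Proof.
move=> us injl injh FG GF.
(* Tagging each nonzero value with the position of its end point makes the lists duplicate-free; it
   is then enough that they have the same members. *)
have sumE (k : I -> R) (H : I -> R) : \sum_(T <- s) H T =
    \sum_(p <- [seq (k T, H T) | T <- s & H T != 0]) p.2.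
  rewrite big_map big_filter [RHS]big_mkcond /=.
  by apply: eq_bigr => T _; case: eqP.
rewrite (sumE h F) (sumE l G); apply: perm_big; apply: uniq_perm.
- rewrite map_inj_in_uniq ?filter_uniq// => T T'; rewrite !mem_filter.
  by move=> /andP[_ Ts] /andP[_ T's] [/injh ->].
- rewrite map_inj_in_uniq ?filter_uniq// => T T'; rewrite !mem_filter.
  by move=> /andP[_ Ts] /andP[_ T's] [/injl ->].
move=> p; apply/mapP/mapP => -[T]; rewrite mem_filter => /andP[T0 Ts] ->.
  have [T' T's [e1 e2]] := FG _ Ts T0; exists T'; last by rewrite e1 e2.
  by rewrite mem_filter e2 T0.
have [T' T's [e1 e2]] := GF _ Ts T0; exists T'; last by rewrite e1 e2.
by rewrite mem_filter e2 T0.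
Qed.

End Telescoping.

(** * Cellwise defined functions on the mesh *)

Section Mesh.
Variables (R : realType) (Omega : set (R3 R)) (Th : seq (box R)).
Hypotheses (oO : open Omega) (mesh : cuboid_mesh Omega Th).
Implicit Types (x y : R3 R) (i j a m : 'I_3) (f g : R3 R -> R) (t : R).
Implicit Types (T E : box R) (P : box R -> R3 R -> R).

(** Interiors of distinct cells are disjoint, so at most one term is nonzero; [undup] keeps a cell
    listed twice from counting twice. The value 0 on the faces concerns a null set only. *)
Definition piecewise P x := \sum_(T <- undup Th) \1_(box_inner T) x * P T x.

Lemma tame_piecewise P : (forall T, continuous (P T)) -> tame (piecewise P).
Proof. by move=> cP; apply: tame_sum => T; exact: tame_indic. Qed.

(** Coordinate [a] of [x] is left free: [x] stands for its whole line parallel to the x_a-axis. *)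
Definition crosses a x T :=
  [forall m, (m != a) ==> (lo T m < crd x m < hi T m)].

Lemma crossesP a x T :
  reflect (forall m, m != a -> lo T m < crd x m < hi T m) (crosses a x T).
Proof.
by apply: (iffP forallP) => H m; [move/implyP: (H m); apply|apply/implyP/H].
Qed.

Lemma box_inner_upd a x T t :
  box_inner T (upd x a t) <-> crosses a x T /\ lo T a < t < hi T a.
Proof.
split=> [xT|[/crossesP cT tT] m].
  split; last by have := xT a; rewrite crd_upd eqxx.
  by apply/crossesP => m ma; have := xT m; rewrite crd_upd (negPf ma).
by rewrite crd_upd; case: eqP => [->//|/eqP]; exact: cT.
Qed.

Lemma line_integral a x T f : C1_along a f -> T \in Th ->
  let h t := (\1_(box_inner T) (upd x a t) * partial a f (upd x a t))%:E in
  (leb R).-integrable setT h /\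
  (\int[leb R]_t h t = (if crosses a x T then
     f (upd x a (hi T a)) - f (upd x a (lo T a)) else 0)%:E)%E.
Proof.
move=> f1 TTh h; case: ifPn => cT; last first.
  rewrite (_ : h = cst 0%E); last first.
    apply/funext => t; rewrite /h indicE memNset ?mul0r// => /box_inner_upd[cT' _].
    by rewrite cT' in cT.
  by split; [exact: integrable0|rewrite integral0].
have [cu _ _ _] := mesh.
have lh : lo T a < hi T a by exact: cu.
have -> : h = (fun t => (partial a f (upd x a t))%:E) \_ `]lo T a, hi T a[.
  apply/funext => t; rewrite /h /patch indicE.
  have -> : (upd x a t \in box_inner T) = (t \in `]lo T a, hi T a[%classic).
    apply/idP/idP => /set_mem tT; apply/mem_set; move: tT; rewrite /= in_itv /=.
      by move=> /box_inner_upd[].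
    by move=> tT; apply/box_inner_upd.
  by case: ifP; rewrite ?mul1r ?mul0r.
rewrite -integral_mkcond FTC_along//; split=> //.
have [cf df cf'] := f1.
apply: (proj1 (@integrable_mkcond _ _ R (leb R) `]lo T a, hi T a[
  (fun t => (partial a f (upd x a t))%:E) _)) => //.
have ci : (leb R).-integrable `[lo T a, hi T a]
    (EFin \o (fun t => partial a f (upd x a t))).
  apply: continuous_compact_integrable; first exact: segment_compact.
  apply: continuous_subspaceT => t.
  by apply: continuous_comp; [exact: upd_continuous|exact: cf'].
by apply: integrableS ci => //; exact: subset_itv_oo_cc.
Qed.

(** Provides a step that stays in a given ball and is shorter than the distance to every other cell
    boundary. *)
Lemma positive_lower_bound (s : seq R) (e : R) : 0 < e ->
  exists2 d, 0 < d < e & {in s, forall v, v != 0 -> d < `|v|}.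
Proof.
move=> e0; elim: s => [|v s [d de dP]].
  by exists (e / 2) => //; lra.
have [->|v0] := eqVneq v 0.
  exists d => // w; rewrite inE => /orP[/eqP->|/dP//]; by rewrite eqxx.
exists (Num.min d (`|v| / 2)).
  have : 0 < `|v| by rewrite normr_gt0.
  move=> ?; rewrite lt_min gt_min; apply/andP.
  by split; [apply/andP; split|apply/orP; left]; lra.
have : 0 < `|v| by rewrite normr_gt0.
move=> ? w; rewrite inE => /orP[/eqP-> _|ws w0]; rewrite gt_min.
  by apply/orP; right; lra.
by apply/orP; left; exact: dP.
Qed.

Definition bnd (up : bool) T a := if up then hi T a else lo T a.

(* Moving a little beyond the face of T through which the line leaves T, one
   enters another cell T', which meets T exactly in that face. *)
Lemma neighbour a x T up : T \in Th -> crosses a x T ->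
  Omega (upd x a (bnd up T a)) ->
  exists T' E, [/\ T' \in Th, crosses a x T', bnd (~~ up) T' a = bnd up T a,
    subentity E T /\ subentity E T' &
    [/\ lo E a = bnd up T a, hi E a = bnd up T a &
        forall m, m != a -> lo E m < hi E m]].
Proof.
move=> TTh /crossesP cT; set c := bnd up T a; set y := upd x a c => Oy.
have [cu cov dis ftf] := mesh.
have [e /= e0 ye] : nbhs_ball y Omega by apply/nbhs_ballP; exact: open_nbhs_nbhs.
have [d de dP] := positive_lower_bound
  ([seq lo T' a - c | T' <- Th] ++ [seq hi T' a - c | T' <- Th]) e0.
have dlo T' : T' \in Th -> lo T' a != c -> d < `|lo T' a - c|.
  move=> T'Th lc; apply: dP; last by rewrite subr_eq0.
  by rewrite mem_cat (map_f (fun T => lo T a - c)).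
have dhi T' : T' \in Th -> hi T' a != c -> d < `|hi T' a - c|.
  move=> T'Th lc; apply: dP; last by rewrite subr_eq0.
  by rewrite mem_cat (map_f (fun T => hi T a - c)) ?orbT.
pose z := upd x a (if up then c + d else c - d).
(* [z] lies at distance [d] beyond the face, still in the ball around [y], so some cell [T']
   contains it. *)
have : closure Omega z.
  apply: subset_closure; apply: ye; apply: ball_crd => m; rewrite !crd_upd.
  case: eqP => _; last by rewrite subrr normr0.
  by case: (up); rewrite ltr_norml; lra.
rewrite cov => -[T' /= T'Th zT'].
have yT : box_set T y.
  move=> m; rewrite crd_upd; case: eqP => [->|/eqP/cT]; last by lra.
  have := cu _ TTh a; rewrite /c /bnd; case: (up) => ?; lra.
have zT'a := zT' a; rewrite crd_upd eqxx in zT'a.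
(* By the choice of [d], no cell ends strictly between the planes of [y] and [z], so [T'] reaches
   back to [y]. *)
have yT' : box_set T' y.
  move=> m; have := zT' m; rewrite !crd_upd; case: eqP => [->|//] _.
  have [lc|/(dlo _ T'Th)] := eqVneq (lo T' a) c;
  have [hc|/(dhi _ T'Th)] := eqVneq (hi T' a) c;
  move: zT'a; case: (up) => ?; rewrite ?ltr_normr; lra.
have [TT'0|[E [ET ET' EE]]] := ftf _ _ TTh T'Th.
  by have : set0 y by rewrite -TT'0.
have yE : box_set E y by rewrite -EE.
(* In the directions other than [a], the point [y] of [E] is strictly inside [T]; hence [E] is not
   degenerate there and has the full extent of [T], and then also of [T']. *)
have Em m : m != a -> lo E m = lo T m /\ hi E m = hi T m.
  move=> ma; case: (ET m) => // -[lhE lE].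
  have := yE m; have := cT _ ma; rewrite crd_upd (negPf ma).
  by case: lE => lE; lra.
have ltE m : m != a -> lo E m < hi E m.
  by move=> ma; have [-> ->] := Em _ ma; exact: cu.
have T'm m : m != a -> lo T' m = lo T m /\ hi T' m = hi T m.
  move=> ma; have [<- <-] := Em _ ma; have := ltE _ ma.
  by case: (ET' m) => [[-> ->]//|[-> _]]; rewrite ltxx.
have yEa := yE a; rewrite crd_upd eqxx in yEa.
have luT := cu _ TTh a; have luT' := cu _ T'Th a.
(* [T'] contains a point beyond the plane where [T] ends, so the two cannot share a full extent in
   direction [a], and [E] is degenerate there. *)
have [lEc hEc] : lo E a = c /\ hi E a = c.
  move: (ET a) (ET' a) zT'a yEa; rewrite /c /bnd.
  by case: (up) => -[[-> ->]|[-> _]] [[? ?]|[? ?]] ? ?; split; lra.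
exists T', E; split=> //.
- by apply/crossesP => m ma; have [-> ->] := T'm _ ma; exact: cT.
- move: (ET' a) zT'a; rewrite lEc hEc /c /bnd.
  by case: (up) => /= -[[? ?]|[_ [?|?]]]; lra.
Qed.

(** Equality is asked on the whole plane of the common face, which polynomials satisfy once they
    agree on the face; no point need then be located within the face. *)
Definition conforming a P := {in Th &, forall T T' E, subentity E T ->
  subentity E T' -> lo E a = hi E a -> (forall m, m != a -> lo E m < hi E m) ->
  forall y, crd y a = lo E a -> P T y = P T' y}.

(** The midpoint of the overlap would lie in the interiors of both cells. *)
Lemma crosses_inj a x T T' : T \in Th -> T' \in Th ->
  crosses a x T -> crosses a x T' ->
  Num.max (lo T a) (lo T' a) < Num.min (hi T a) (hi T' a) -> T = T'.
Proof.
move=> TTh T'Th cT cT'; rewrite gt_max !lt_min => /andP[/andP[l1 l2] /andP[l3 l4]].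
have [cu _ dis _] := mesh.
apply/eqP/negP => /negP TT'; have := dis _ _ TTh T'Th TT'.
pose t := (Num.max (lo T a) (lo T' a) + Num.min (hi T a) (hi T' a)) / 2.
move=> /seteqP[+ _] => /(_ (upd x a t)); apply; rewrite /t.
split; apply/box_inner_upd; split=> //;
  by case: (leP (lo T a) (lo T' a)) => ?; case: (leP (hi T a) (hi T' a)) => ?; lra.
Qed.

Lemma sum_line_zero a x P g : conforming a P -> (forall y, g y != 0 -> Omega y) ->
  \sum_(T <- undup Th) (if crosses a x T then
     (P T \* g) (upd x a (hi T a)) - (P T \* g) (upd x a (lo T a)) else 0) = 0.
Proof.
move=> confP gO; have [cu _ _ _] := mesh.
rewrite -big_mkcond -big_filter sumrB; apply/eqP; rewrite subr_eq0; apply/eqP.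
set s := [seq T <- undup Th | _].
have sP T : (T \in s) = (T \in Th) && crosses a x T.
  by rewrite mem_filter mem_undup andbC.
(* Two crossed cells with the same upper, or the same lower, end overlap just inside that end. *)
have injb up : {in s &, injective (fun T => bnd up T a)}.
  move=> T T'; rewrite !sP => /andP[TTh cT] /andP[T'Th cT'] e.
  apply: (crosses_inj (a := a) (x := x)) => //.
  have := cu _ TTh a; have := cu _ T'Th a.
  by rewrite gt_max !lt_min; move: e; rewrite /bnd; case: (up) => -> ? ?;
    apply/andP; split; apply/andP; split; lra.
have H up : {in s, forall T, (P T \* g) (upd x a (bnd up T a)) != 0 ->
    exists2 T', T' \in s & bnd (~~ up) T' a = bnd up T a /\
      (P T' \* g) (upd x a (bnd (~~ up) T' a)) =
      (P T \* g) (upd x a (bnd up T a))}.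
  move=> T; rewrite sP => /andP[TTh cT]; rewrite /= mulf_eq0 negb_or => /andP[_].
  move=> /gO /(neighbour TTh cT)[T' [E [T'Th cT' bT' [ET ET'] [lE hE ltE]]]].
  exists T'; first by rewrite sP T'Th.
  split=> //; rewrite bT' (confP _ _ T'Th TTh E)// ?lE ?hE//.
  by rewrite crd_upd eqxx.
apply: sum_endpoints (injb false) (injb true) (H true) (H false).
by rewrite filter_uniq// undup_uniq.
Qed.

Lemma integral_piecewise_partial a P g : conforming a P ->
  (forall T, C1_along a (P T)) -> C1_along a g ->
  (forall y, g y != 0 -> Omega y) ->
  (\int[leb3 R]_x (piecewise (fun T => partial a (P T \* g)) x)%:E = 0)%E.
Proof.
move=> confP cP cg gO.
have cPg T : C1_along a (P T \* g) by exact: C1_alongM.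
have [mf [N [M [fM f0]]]] : tame (piecewise (fun T => partial a (P T \* g))).
  by apply: tame_piecewise => T; have [_ _] := cPg T.
apply: (integral3_zero (a := a) mf fM f0) => x.
(* [integral_sum] asks for integrability at every index, while [line_integral] gives it for cells of
   the mesh; other indices get 0. *)
pose h T t := if T \in Th then
  (\1_(box_inner T) (upd x a t) * partial a (P T \* g) (upd x a t))%:E else 0%E.
have hE t : (piecewise (fun T => partial a (P T \* g)) (upd x a t))%:E =
    (\sum_(T <- undup Th) h T t)%E.
  rewrite /piecewise -sumEFin !big_seq; apply: eq_bigr => T.
  by rewrite mem_undup /h => ->.
have hi T : (leb R).-integrable setT (h T).
  rewrite /h; case: (boolP (T \in Th)) => [TTh|_]; last exact: integrable0.
  by have [] := line_integral x (cPg T) TTh.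
under eq_integral do rewrite hE.
rewrite integral_sum//; apply: (etrans _ (congr1 EFin (sum_line_zero x confP gO))).
rewrite -sumEFin !big_seq; apply: eq_bigr => T; rewrite mem_undup => TTh.
have [_ <-] := line_integral x (cPg T) TTh.
by rewrite /h TTh.
Qed.

Lemma eq_piecewise P Q x : (forall T, P T x = Q T x) -> piecewise P x = piecewise Q x.
Proof. by move=> PQ; apply: eq_bigr => T _; rewrite PQ. Qed.

Lemma piecewiseMr P g x : piecewise P x * g x = piecewise (fun T => P T \* g) x.
Proof. by rewrite mulr_suml; apply: eq_bigr => T _; rewrite mulrA. Qed.

Lemma piecewiseD P Q x :
  piecewise (fun T => P T \+ Q T) x = piecewise P x + piecewise Q x.
Proof. by rewrite -big_split; apply: eq_bigr => T _; rewrite mulrDr. Qed.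

Lemma piecewise_by_parts a P g : conforming a P ->
  (forall T, C1_along a (P T)) -> C1_along a g ->
  (forall y, g y != 0 -> Omega y) ->
  \int[leb3 R]_x (piecewise P x * partial a g x) =
  - \int[leb3 R]_x (piecewise (fun T => partial a (P T)) x * g x).
Proof.
move=> confP cP cg gO.
have tPg' : tame (piecewise (fun T => P T \* partial a g)).
  apply: tame_piecewise => T y; apply: cvgM; first by have [+ _ _] := cP T; apply.
  by have [_ _] := cg; apply.
have tP'g : tame (piecewise (fun T => partial a (P T) \* g)).
  apply: tame_piecewise => T y; apply: cvgM; first by have [_ _] := cP T; apply.
  by have [+ _ _] := cg; apply.
have e := integral_piecewise_partial confP cP cg gO.
apply/eqP; rewrite -addr_eq0; apply/eqP.
under eq_Rintegral do rewrite piecewiseMr.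
under [X in _ + X]eq_Rintegral do rewrite piecewiseMr.
rewrite -RintegralD//; try exact: tame_integrable.
rewrite /Rintegral -[RHS]/(fine 0%E) -e; congr fine.
apply: eq_integral => x _; rewrite -piecewiseD; congr EFin; apply: eq_piecewise => T.
rewrite partialM//; first by have [_ + _] := cP T.
by have [_ + _] := cg.
Qed.

End Mesh.

(** * Determining functionals in one variable *)

Section Functionals.
Variable R : realType.
Implicit Types (p q r w : {poly R}) (l h t c : R).

Definition mom l h q p : R := \int[leb R]_(t in `[l, h]) (p.[t] * q.[t]).

Definition linear_functional (lam : {poly R} -> R) :=
  forall c p q, lam (c *: p + q) = c * lam p + lam q.

Lemma linear_functional_sum lam (I : Type) (s : seq I) (c : I -> R)
    (F : I -> {poly R}) : linear_functional lam ->
  lam (\sum_(i <- s) c i *: F i) = \sum_(i <- s) c i * lam (F i).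
Proof.
move=> ll; elim: s => [|i s ih]; last by rewrite !big_cons ll ih.
by rewrite !big_nil; have := ll (- 1) 0 0; rewrite scaler0 addr0 mulN1r addNr.
Qed.

Lemma integrable_horner l h p :
  (leb R).-integrable `[l, h] (EFin \o (fun t => p.[t])).
Proof.
apply: continuous_compact_integrable; first exact: segment_compact.
by apply: continuous_subspaceT; exact: continuous_horner.
Qed.

Lemma mom_linear l h q : linear_functional (mom l h q).
Proof.
move=> c p p'; rewrite /mom.
have E (u v : {poly R}) t : u.[t] * v.[t] = (u * v).[t] by rewrite hornerM.
under eq_Rintegral do rewrite E.
under [X in _ = c * X + _]eq_Rintegral do rewrite E.
under [X in _ = _ + X]eq_Rintegral do rewrite E.
rewrite -RintegralZl//; last exact: integrable_horner.
have ic : (leb R).-integrable `[l, h] (EFin \o (fun t => c * (p * q).[t])).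
  have := integrable_horner l h (c *: (p * q)).
  by congr (is_true (_.-integrable _ _)); apply/funext => t; rewrite /= hornerZ.
rewrite -RintegralD//; last exact: integrable_horner.
by apply: eq_Rintegral => t _; rewrite mulrDl -scalerAl hornerD hornerZ.
Qed.

Lemma horner_linear t : linear_functional (fun p => p.[t]).
Proof. by move=> c p q; rewrite hornerD hornerZ. Qed.

Lemma horner_deriv_linear t : linear_functional (fun p => p^`().[t]).
Proof. by move=> c p q; rewrite derivD derivZ hornerD hornerZ. Qed.

Lemma poly_eq0_oo l h p : l < h -> (forall t, l < t < h -> p.[t] = 0) -> p = 0.
Proof.
move=> lh p0; apply/eqP/negP => /negP pn0.
(* Denominators starting at 2 keep these [size p] distinct points strictly between [l] and [h]: too
   many roots for a nonzero [p]. *)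
pose rs := [seq l + (h - l) / (n.+2)%:R | n <- iota 0 (size p)].
have hl : 0 < h - l by rewrite subr_gt0.
have : (size rs < size p)%N.
  apply: max_poly_roots => //.
    apply/allP => _ /mapP[n _ ->]; apply/eqP; apply: p0.
    rewrite ltrDl divr_gt0//= -ltrBrDl gtr_pMr//.
    by rewrite invf_lt1// ltr1n.
  rewrite map_inj_uniq ?iota_uniq// => m n /addrI.
  move=> /(mulfI (lt0r_neq0 hl)) /invr_inj /eqP.
  by rewrite eqr_nat => /eqP [].
by rewrite size_map size_iota ltnn.
Qed.

Definition antiderivative p : {poly R} := \poly_(i < (size p).+1) (p`_i.-1 / i%:R).

Lemma deriv_antiderivative p : (antiderivative p)^`() = p.
Proof.
apply/polyP => i; rewrite coef_deriv coef_poly /= ltnS.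
case: ltnP => ip; last by rewrite mul0rn nth_default.
by rewrite -[RHS](@divfK _ i.+1%:R) ?pnatr_eq0// mulr_natr.
Qed.

Lemma integral_horner l h p : l < h ->
  \int[leb R]_(t in `[l, h]) p.[t] = (antiderivative p).[h] - (antiderivative p).[l].
Proof.
move=> lh; rewrite /Rintegral (@continuous_FTC2 _ _ (horner (antiderivative p)))//.
- by apply: continuous_subspaceT; exact: continuous_horner.
- split=> [t _||]; first exact: derivable_horner.
  + by apply: cvg_at_right_filter; exact: continuous_horner.
  + by apply: cvg_at_left_filter; exact: continuous_horner.
- by move=> t _; rewrite -derive.derivE deriv_antiderivative.
Qed.

(** The antiderivative is nondecreasing with equal values at both ends, hence constant, and [p] is
    its derivative. *)
Lemma integral_horner_eq0 l h p : l < h -> (forall t, l < t < h -> 0 <= p.[t]) ->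
  \int[leb R]_(t in `[l, h]) p.[t] = 0 -> p = 0.
Proof.
move=> lh p0; rewrite integral_horner// => e.
have mono (u v : R) : l <= u -> u < v -> v <= h ->
    (antiderivative p).[u] <= (antiderivative p).[v].
  move=> lu uv vh; have [|t|t] := @MVT R (horner (antiderivative p)) (horner p) u v uv.
  - by move=> t _; have := is_derive_poly (antiderivative p) t; rewrite deriv_antiderivative.
  - by apply: continuous_subspaceT; exact: continuous_horner.
  - rewrite in_itv /= => tuv E; rewrite -subr_ge0 E mulr_ge0 ?p0//; lra.
have cst : antiderivative p - (antiderivative p).[l]%:P = 0.
  apply: (poly_eq0_oo lh) => t tlh; rewrite hornerD hornerN hornerC.
  by have := mono l t; have := mono t h; lra.
rewrite -(deriv_antiderivative p).
by move/eqP: cst; rewrite subr_eq0 => /eqP ->; rewrite derivC.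
Qed.

(** The moment is the integral of w r^2, which is nonnegative on the interval. *)
Lemma mom_weight_eq0 l h w r : l < h ->
  (forall t, l < t < h -> 0 < w.[t]) -> mom l h r (w * r) = 0 -> r = 0.
Proof.
move=> lh w0; rewrite /mom.
under eq_Rintegral do rewrite -hornerM.
move=> /(integral_horner_eq0 lh) wr0.
have {}wr0 : w * r * r = 0.
  by apply: wr0 => t /w0 /ltW wt; rewrite !hornerM -mulrA mulr_ge0// -expr2 sqr_ge0.
have wn0 : w != 0.
  apply/eqP => w00; have /w0 : l < (l + h) / 2 < h by lra.
  by rewrite w00 horner0 ltxx.
by move/eqP: wr0; rewrite -mulrA mulf_eq0 (negPf wn0) mulf_eq0 orbb => /eqP.
Qed.

Definition bubble l h : {poly R} := ('X - l%:P) * ('X - h%:P).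

Lemma bubbleE l h t : (bubble l h).[t] = (t - l) * (t - h).
Proof. by rewrite hornerM !hornerXsubC. Qed.

Lemma size_bubble l h : size (bubble l h) = 3%N.
Proof. by rewrite size_mul ?polyXsubC_eq0// !size_XsubC. Qed.

Lemma bubble_factor l h p : l < h -> p.[l] = 0 -> p.[h] = 0 ->
  exists2 r, p = bubble l h * r & (size r <= size p - 2)%N.
Proof.
move=> lh pl ph.
have /factor_theorem[r pr] : root p h by apply/eqP.
have : root r l.
  move: pl; rewrite pr hornerM hornerXsubC => /eqP; rewrite mulf_eq0 => /orP[//|].
  by rewrite subr_eq0 => /eqP e; rewrite e ltxx in lh.
move=> /factor_theorem[r' rr'].
have pE : p = bubble l h * r' by rewrite pr rr' /bubble; ring.
exists r' => //; have [->|r0] := eqVneq r' 0; first by rewrite size_poly0.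
rewrite {}pE size_mul// -?size_poly_gt0 ?size_bubble//=.
by rewrite subn2.
Qed.

(** The uniqueness half of unisolvence; [n] bounds the size, that is, degree plus one. *)
Definition determining n (Lam : set ({poly R} -> R)) :=
  (forall lam, Lam lam -> linear_functional lam) /\
  forall p, (size p <= n)%N -> (forall lam, Lam lam -> lam p = 0) -> p = 0.

Definition moments l h n : set ({poly R} -> R) :=
  [set lam | exists2 q : {poly R}, (size q <= n)%N & lam = mom l h q].

Definition values l h : set ({poly R} -> R) :=
  [set lam | exists2 t, t \in [:: l; h] & lam = fun p => p.[t]].

Definition slopes l h : set ({poly R} -> R) :=
  [set lam | exists2 t, t \in [:: l; h] & lam = fun p => p^`().[t]].

Lemma moments_determining l h n : l < h -> determining n (moments l h n).
Proof.
move=> lh; split=> [_ [q _ ->]|p pn H]; first exact: mom_linear.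
apply: (@mom_weight_eq0 l h 1) => // [t _|]; first by rewrite hornerC.
by rewrite mul1r; apply: H; exists p.
Qed.

(** Zero end values split off the factor [bubble l h], and the cofactor is small enough to serve as
    its own test polynomial. The weight is the opposite of the bubble, which is negative between its
    roots. *)
Lemma values_moments_determining l h n : l < h ->
  determining n (values l h `|` moments l h (n - 2)).
Proof.
move=> lh; split=> [_ [[t _ ->]|[q _ ->]]|p pn H].
- exact: horner_linear.
- exact: mom_linear.
have [|||r pr sr] := @bubble_factor l h p => //.
- by apply: (H (fun p => p.[l])); left; exists l; rewrite ?mem_head.
- by apply: (H (fun p => p.[h])); left; exists h; rewrite ?inE ?eqxx ?orbT.
suff r0 : r = 0 by rewrite pr r0 mulr0.
apply: (@mom_weight_eq0 l h (- bubble l h)) => // [t tlh|].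
  by rewrite hornerN bubbleE; nra.
have : mom l h r p = 0.
  by apply: H; right; exists r => //; rewrite (leq_trans sr)// leq_sub2r.
rewrite pr mulNr -scaleN1r.
have := mom_linear l h r (-1) (bubble l h * r) 0.
have := mom_linear l h r 0 0 0; rewrite scale0r addr0 mul0r add0r => m0.
rewrite addr0 => -> ->; rewrite mulr0 add0r.
by have := mom_linear l h r (-1) 0 0; rewrite scaler0 addr0; lra.
Qed.

(** Both ends are double roots, so the square of the bubble splits off and is a positive weight
    inside the interval. *)
Lemma Hermite_moments_determining l h n : l < h ->
  determining n (values l h `|` slopes l h `|` moments l h (n - 4)).
Proof.
move=> lh; split=> [_ [[[t _ ->]|[t _ ->]]|[q _ ->]]|p pn H].
- exact: horner_linear.
- exact: horner_deriv_linear.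
- exact: mom_linear.
have [|||r pr sr] := @bubble_factor l h p => //.
- by apply: (H (fun p => p.[l])); left; left; exists l; rewrite ?mem_head.
- by apply: (H (fun p => p.[h])); left; left; exists h; rewrite ?inE ?eqxx ?orbT.
(* At an end point the bubble vanishes but its derivative does not, so a zero slope of [p] forces a
   zero of the cofactor. *)
have dp t : t \in [:: l; h] -> r.[t] = 0.
  move=> tlh; have : p^`().[t] = 0.
    by apply: (H (fun p => p^`().[t])); left; right; exists t.
  rewrite pr derivM hornerD !hornerM.
  have -> : (bubble l h)^`().[t] = (t - l) + (t - h).
    by rewrite derivM !derivXsubC mul1r mulr1 hornerD !hornerXsubC addrC.
  move: tlh; rewrite !hornerXsubC !inE => /orP[]/eqP->;
    rewrite subrr ?mulr0 ?mul0r ?addr0 ?add0r => /eqP;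
    rewrite mulf_eq0 subr_eq0 => /orP[/eqP e|/eqP//]; lra.
have [|||r' rr' sr'] := @bubble_factor l h r => //.
- by apply: dp; rewrite mem_head.
- by apply: dp; rewrite !inE eqxx orbT.
suff r'0 : r' = 0 by rewrite pr rr' r'0 !mulr0.
apply: (@mom_weight_eq0 l h (bubble l h * bubble l h)) => // [t tlh|].
  by rewrite hornerM -expr2 exprn_even_gt0//= bubbleE mulf_neq0//; lra.
rewrite -mulrA -rr' -pr; apply: H; right; exists r' => //.
rewrite (leq_trans sr')// -[4%N]/(2 + 2)%N subnDA leq_sub2r//.
by rewrite (leq_trans sr)// leq_sub2r.
Qed.

(* Fixing one functional in the second variable leaves a polynomial in the first
   one, which the first family determines; then the roles are exchanged. *)
Lemma tensor_determining m n (Lam Mu : set ({poly R} -> R))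
    (s : seq ({poly R} * {poly R})) :
  determining m Lam -> determining n Mu ->
  all (fun k : {poly R} * {poly R} => (size k.1 <= m)%N && (size k.2 <= n)%N) s ->
  (forall lam mu, Lam lam -> Mu mu -> \sum_(k <- s) lam k.1 * mu k.2 = 0) ->
  forall u v, \sum_(k <- s) k.1.[u] * k.2.[v] = 0.
Proof.
move=> [linL detL] [linM detM] /allP sz H u v.
have size_sum (F : {poly R} * {poly R} -> {poly R}) (c : {poly R} * {poly R} -> R) d :
    (forall k, k \in s -> (size (F k) <= d)%N) ->
    (size (\sum_(k <- s) c k *: F k)%R <= d)%N.
  move=> Fd; rewrite big_seq; elim/big_ind: _ => [|p q pd qd|k ks].
  - by rewrite size_poly0.
  - by rewrite (leq_trans (size_polyD _ _))// geq_max pd.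
  - by rewrite (leq_trans (size_scale_leq _ _))// Fd.
have evE (F : {poly R} * {poly R} -> {poly R}) (c : {poly R} * {poly R} -> R) t :
    (\sum_(k <- s) c k *: F k).[t] = \sum_(k <- s) c k * (F k).[t].
  by rewrite horner_sum; apply: eq_bigr => k _; rewrite hornerZ.
have : \sum_(k <- s) k.1.[u] *: k.2 = 0.
  apply: detM => [|mu Mmu]; first by apply: size_sum => k /sz /andP[].
  rewrite linear_functional_sum//; last exact: linM.
  have : \sum_(k <- s) mu k.2 *: k.1 = 0.
    apply: detL => [|lam Llam]; first by apply: size_sum => k /sz /andP[].
    rewrite linear_functional_sum//; last exact: linL.
    by rewrite -[RHS](H _ _ Llam Mmu); apply: eq_bigr => k _; rewrite mulrC.
  move=> /(congr1 (fun p => p.[u])); rewrite evE horner0 => {2}<-.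
  by apply: eq_bigr => k _; rewrite mulrC.
by move=> /(congr1 (fun p => p.[v])); rewrite evE horner0.
Qed.

End Functionals.

(** * Sums of tensors and their degrees of freedom *)

Section TensorSums.
Variable R : realType.
Implicit Types (x y : R3 R) (i j l a b c m : 'I_3) (f g : R3 R -> R) (t z : R).
Notation tensor := {ffun 'I_3 -> {poly R}}.
Implicit Types (Q : tensor) (s : seq tensor).

Definition tensor_eval Q x := \prod_m (Q m).[crd x m].
Definition tensors_eval s x := \sum_(Q <- s) tensor_eval Q x.

(** Written with sizes, so that a negative bound leaves only the zero polynomial. *)
Definition degrees_le (d : 'I_3 -> int) s :=
  forall Q m, Q \in s -> (size (Q m))%:Z <= d m + 1.

Definition tensor_deriv a Q : tensor :=
  [ffun m => if m == a then (Q a)^`() else Q m].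

Lemma degrees_le_deriv d a s :
  degrees_le d s -> degrees_le d (map (tensor_deriv a) s).
Proof.
move=> ds _ m /mapP[Q Qs ->]; rewrite ffunE; case: eqP => [->|_]; last exact: ds.
apply: le_trans (ds _ a Qs); rewrite lez_nat.
have [->|Q0] := eqVneq (Q a) 0; first by rewrite deriv0.
by rewrite ltnW// lt_size_deriv.
Qed.

Lemma tensor_evalE a b c Q x : distinct3 a b c ->
  tensor_eval Q x = (Q a).[crd x a] * (Q b).[crd x b] * (Q c).[crd x c].
Proof.
rewrite /distinct3 /= !inE negb_or andbT => /andP[/andP[ab ac] bc].
rewrite /tensor_eval (bigD1 a)//= (bigD1 b) 1?eq_sym//= (bigD1 c); last first.
  by rewrite !(eq_sym c) ac bc.
rewrite big_pred0 /= ?mulr1 ?mulrA// => m; apply/negbTE; rewrite !negb_and !negbK.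
have : uniq [:: m; a; b; c] -> False.
  by move=> /card_uniqP u; have := max_card (mem [:: m; a; b; c]); rewrite u card_ord.
rewrite /= !inE !negb_or ab ac bc !andbT; case: (m == a); case: (m == b);
  by case: (m == c) => //= /(_ isT).
Qed.

(** Freezing the other coordinates gives a polynomial in x_a, whose formal derivative computes the
    partial derivative. *)
Definition line_poly x a s : {poly R} :=
  \sum_(Q <- s) (\prod_(m | m != a) (Q m).[crd x m]) *: Q a.

Lemma tensors_eval_upd x a s t :
  tensors_eval s (upd x a t) = (line_poly x a s).[t].
Proof.
rewrite /line_poly horner_sum; apply: eq_bigr => Q _.
rewrite /tensor_eval (bigD1 a)//= crd_upd eqxx hornerZ mulrC; congr (_ * _).
by apply: eq_bigr => m ma; rewrite crd_upd (negPf ma).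
Qed.

Lemma derivable_tensors_eval s a x : derivable (tensors_eval s) x (basis_vec R a).
Proof.
apply/derivable_upd; rewrite (_ : (fun t => _) = horner (line_poly x a s)).
  exact: derivable_horner.
by apply/funext => t; rewrite tensors_eval_upd.
Qed.

Lemma partial_tensors_eval s a :
  partial a (tensors_eval s) = tensors_eval (map (tensor_deriv a) s).
Proof.
apply/funext => x; rewrite partial_derive1.
rewrite (_ : (fun t => _) = horner (line_poly x a s)); last first.
  by apply/funext => t; rewrite tensors_eval_upd.
rewrite -derive.derivE -[in RHS](upd_crd x a) tensors_eval_upd; congr _.[_].
rewrite /line_poly big_map linear_sum; apply: eq_bigr => Q _.
rewrite linearZ /= ffunE eqxx; congr (_ *: _).
by apply: eq_bigr => m ma; rewrite ffunE (negPf ma).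
Qed.

Lemma continuous_horner_crd (p : {poly R}) m :
  continuous (fun x : R3 R => p.[crd x m]).
Proof.
move=> x; apply: (@continuous_comp _ _ _ (fun y : R3 R => crd y m) (horner p)).
  exact: crd_continuous.
exact: continuous_horner.
Qed.

Lemma continuous_tensors_eval s : continuous (tensors_eval s).
Proof.
elim: s => [|Q s ih] x.
  rewrite (_ : tensors_eval [::] = fun=> 0); first exact: cst_continuous.
  by apply/funext => y; rewrite /tensors_eval big_nil.
rewrite (_ : tensors_eval (Q :: s) = tensor_eval Q \+ tensors_eval s); last first.
  by apply/funext => y; rewrite /tensors_eval big_cons.
apply: cvgD; last exact: ih.
have d : distinct3 0 1 2 by [].
rewrite (_ : tensor_eval Q = fun y =>
    (Q 0).[crd y 0] * (Q 1).[crd y 1] * (Q 2).[crd y 2]).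
  by apply: cvgM; [apply: cvgM|]; exact: continuous_horner_crd.
by apply/funext => y; rewrite (tensor_evalE _ _ d).
Qed.

Lemma C1_tensors_eval s a : C1_along a (tensors_eval s).
Proof.
split; [exact: continuous_tensors_eval|move=> x; exact: derivable_tensors_eval|].
by rewrite partial_tensors_eval; exact: continuous_tensors_eval.
Qed.

Lemma Qspace_tensors (d : 'I_3 -> int) f : Qspace d f ->
  exists2 s, degrees_le d s & f = tensors_eval s.
Proof.
move=> [N [c [cd fE]]].
(* The coefficient of a monomial is carried by its factor in coordinate 0. Zero coefficients are
   filtered out next, as their exponents obey no bound. *)
pose Q (e : {ffun 'I_3 -> 'I_N}) : tensor :=
  [ffun m => (if m == 0 then c e else 1) *: 'X^(e m)].
exists [seq Q e | e <- enum {ffun 'I_3 -> 'I_N} & c e != 0].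
  move=> _ m /mapP[e + ->]; rewrite mem_filter => /andP[ce _]; rewrite ffunE.
  have := cd e ce m => em.
  have : (size ((if m == 0%R then c e else 1%R) *: 'X^(e m))%R <= (e m).+1)%N.
    by rewrite (leq_trans (size_scale_leq _ _))// size_polyXn.
  by rewrite -lez_nat => /le_trans; apply; rewrite -addn1 PoszD lerD2r.
apply/funext => x; rewrite fE /tensors_eval big_map big_filter [RHS]big_mkcond /=.
rewrite [RHS]big_enum /=; apply: eq_bigr => e _.
case: eqP => [->|_]; first by rewrite mul0r.
rewrite /tensor_eval (bigD1 (0 : 'I_3))//= [in RHS](bigD1 (0 : 'I_3))//= ffunE eqxx.
rewrite hornerZ hornerXn -mulrA; congr (_ * (_ * _)); apply: eq_bigr => m m0.
by rewrite ffunE (negPf m0) scale1r hornerXn.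
Qed.

Lemma Qspace_prod (d : 'I_3 -> int) (Q : 'I_3 -> {poly R}) :
  (forall m, (size (Q m))%:Z <= d m + 1) ->
  Qspace d (fun x => \prod_m (Q m).[crd x m]).
Proof.
move=> dQ; exists (\max_m size (Q m))%N, 
  (fun e : {ffun 'I_3 -> 'I_(\max_m size (Q m))} => \prod_m (Q m)`_(e m)); split.
  move=> e /prodf_neq0 ce m; rewrite -(lerD2r 1) (le_trans _ (dQ m))//.
  rewrite -PoszD lez_nat addn1 ltnNge; apply/negP => sQ.
  by have := ce m isT; rewrite nth_default ?eqxx.
move=> x; under eq_bigr => m _ do
  rewrite (horner_coef_wide _ (leq_bigmax (F := fun m => size (Q m)) m)).
by rewrite bigA_distr_bigA /=; apply: eq_bigr => e _; rewrite big_split.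
Qed.

(** The tensor product of [lam] and [mu] in the face variables x_a, x_b, applied to the restriction
    to the plane x_c = z. The degrees of freedom on the face, its edges and its vertices all take
    this form. *)
Definition tensors_apply a b c s (lam mu : {poly R} -> R) z :=
  \sum_(Q <- s) lam (Q a) * mu (Q b) * (Q c).[z].

Lemma tensors_applyC a b c s lam mu z :
  tensors_apply a b c s lam mu z = tensors_apply b a c s mu lam z.
Proof. by apply: eq_bigr => Q _; congr (_ * _); rewrite mulrC. Qed.

(** Turns a degree of freedom of a derivative tangential to the face into an end slope in that
    variable. *)
Lemma tensors_apply_deriv a b c s lam mu z : distinct3 a b c ->
  tensors_apply a b c (map (tensor_deriv b) s) lam mu z =
  tensors_apply a b c s lam (fun p => mu p^`()) z.
Proof.
rewrite /distinct3 /= !inE negb_or andbT => /andP[/andP[ab ac] bc].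
rewrite /tensors_apply big_map; apply: eq_bigr => Q _.
by rewrite !ffunE eqxx (negPf ab) eq_sym (negPf bc).
Qed.

Lemma tensors_apply_eval a b c s x : distinct3 a b c ->
  tensors_eval s x =
  tensors_apply a b c s (fun p => p.[crd x a]) (fun p => p.[crd x b]) (crd x c).
Proof. by move=> d; apply: eq_bigr => Q _; rewrite (tensor_evalE _ _ d). Qed.

(* The sums over s and s', the latter with a sign, form a single sum of tensors
   in the two face variables. *)
Lemma tensors_agree a b c s s' (m n : nat) Lam Mu z : distinct3 a b c ->
  determining m Lam -> determining n Mu ->
  (forall Q, Q \in s ++ s' -> (size (Q a) <= m)%N /\ (size (Q b) <= n)%N) ->
  (forall lam mu, Lam lam -> Mu mu ->
     tensors_apply a b c s lam mu z = tensors_apply a b c s' lam mu z) ->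
  forall x, crd x c = z -> tensors_eval s x = tensors_eval s' x.
Proof.
move=> d detL detM sz H x xc.
pose S := [seq (Q a, (Q c).[z] *: Q b) | Q : tensor <- s] ++
          [seq (Q a, - (Q c).[z] *: Q b) | Q : tensor <- s'].
have sumS (lam mu : {poly R} -> R) : (forall k p, mu (k *: p) = k * mu p) ->
    \sum_(k <- S) lam k.1 * mu k.2 =
    tensors_apply a b c s lam mu z - tensors_apply a b c s' lam mu z.
  move=> muZ; rewrite big_cat !big_map /= -sumrN.
  by congr (_ + _); apply: eq_bigr => Q _; rewrite muZ; ring.
have linZ mu : linear_functional mu -> forall k p, mu (k *: p) = k * mu p.
  move=> lm k p; have := lm k p 0; rewrite addr0 => ->.
  by have := lm (-1) 0 0; rewrite scaler0 addr0; lra.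
have szS : all (fun k : {poly R} * {poly R} =>
    (size k.1 <= m)%N && (size k.2 <= n)%N) S.
  rewrite all_cat; apply/andP; split; apply/allP => _ /mapP[Q Qs ->] /=;
    (have [|-> sb] := sz Q; first by rewrite mem_cat Qs ?orbT);
    by rewrite (leq_trans (size_scale_leq _ _)).
have := tensor_determining detL detM szS _ (crd x a) (crd x b).
rewrite (sumS (fun p => p.[crd x a]) (fun p => p.[crd x b])); last first.
  by move=> k p; rewrite hornerZ.
rewrite !(tensors_apply_eval _ _ d) xc => e; apply/eqP; rewrite -subr_eq0; apply/eqP/e.
move=> lam mu Llam Mmu; rewrite sumS ?H ?subrr//.
by apply: linZ; case: detM => + _; apply.
Qed.

End TensorSums.

(** * Degrees of freedom as tensor products of one-variable functionals *)

Section Dofs.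
Variable R : realType.
Implicit Types (x y : R3 R) (i j l a b c m : 'I_3) (f g : R3 R -> R) (t v z : R).
Implicit Types (T E : box R) (q : {poly R}).
Notation tensor := {ffun 'I_3 -> {poly R}}.
Implicit Types (Q : tensor) (s : seq tensor).

Lemma int_edge_tensors a b c E s q : distinct3 a b c ->
  int_edge a E (fun x => tensors_eval s x * q.[crd x a]) =
  tensors_apply a b c s (mom (lo E a) (hi E a) q) (fun p => p.[lo E b]) (lo E c).
Proof.
move=> d; have [ba ca] : b != a /\ c != a.
  by move: d; rewrite /distinct3 /= !inE negb_or andbT => /andP[/andP[]];
    rewrite ![a == _]eq_sym.
rewrite /int_edge; under eq_Rintegral do rewrite tensors_eval_upd crd_upd eqxx.
rewrite -/(mom _ _ _ _) linear_functional_sum; last exact: mom_linear.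
(* With its factor in x_a replaced by 1, the tensor evaluates to the product over the other two
   coordinates. *)
apply: eq_bigr => Q _; have := tensor_evalE [ffun m => if m == a then 1 else Q m] E.1 d.
rewrite /tensor_eval (bigD1 a)//= !ffunE eqxx (negPf ba) (negPf ca) hornerC !mul1r.
under eq_bigr => m ma do rewrite ffunE (negPf ma).
by move=> ->; rewrite mulrC mulrA.
Qed.

(** Integrability is part of the conclusion because [int_face_tensors] sums such products. *)
Lemma integral_tensor (F G : R -> R) (l h l' h' : R) :
  continuous F -> continuous G ->
  (leb2 R).-integrable (`[l, h] `*` `[l', h']) (fun w => (F w.1 * G w.2)%:E) /\
  \int[leb2 R]_(w in `[l, h] `*` `[l', h']) (F w.1 * G w.2) =
  (\int[leb R]_(t in `[l, h]) F t) * (\int[leb R]_(t in `[l', h']) G t).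
Proof.
move=> cF cG.
have iF u v H : continuous H -> (leb R).-integrable `[u, v] (EFin \o H).
  by move=> cH; apply: continuous_compact_integrable;
    [exact: segment_compact|exact: continuous_subspaceT].
have bnd (u v : R) (H : R -> R) : continuous H ->
    exists M, forall t : R, u <= t <= v -> `|H t| <= M.
  move=> cH.
  have := continuous_compact (continuous_subspaceT cH) (@segment_compact R u v).
  move=> /compact_bounded[M [_ MP]]; exists (M + 1) => t tuv.
  by apply: MP; [rewrite ltrDl|exists t => //=; rewrite in_itv].
have fin (u v : R) : (leb R `[u, v] < +oo)%E.
  by rewrite lebesgue_measure_itv; case: ifP => _; rewrite ?ltry.
set D := `[l, h] `*` `[l', h'].
have mD : measurable D by exact: measurableX.
have Dfin : (leb2 R D < +oo)%E.
  by rewrite product_measure1E// lte_mul_pinfty//= ?ge0_fin_numE// ?fin.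
have mFG : measurable_fun setT (fun w : R * R => F w.1 * G w.2).
  apply: measurable_funM; apply: measurableT_comp => //;
  exact: continuous_measurable_fun.
have iFG : (leb2 R).-integrable D (EFin \o (fun w => F w.1 * G w.2)).
  apply: measurable_bounded_integrable => //; first exact: measurable_funTS.
  have [M FM] := bnd l h F cF; have [M' GM] := bnd l' h' G cG.
  exists (M * M'); split; first exact: num_real.
  move=> N MN [u v] [/=]; rewrite !in_itv /= => ulh vlh.
  by rewrite (le_trans _ (ltW MN))// normrM ler_pM// ?FM// GM.
split=> //.
have iFG' : (leb2 R).-integrable setT ((EFin \o (fun w => F w.1 * G w.2)) \_ D).
  by apply: (proj1 (integrable_mkcond _ _) iFG).
rewrite /Rintegral integral_mkcond -(integral12_prod_meas1 iFG') /fubini_F.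
have FE : ((\int[leb R]_(t in `[l, h]) F t)%:E =
    \int[leb R]_(t in `[l, h]) (F t)%:E)%E.
  by apply: fineK; apply: integrable_fin_num => //; exact: iF.
have GE : ((\int[leb R]_(t in `[l', h']) G t)%:E =
    \int[leb R]_(t in `[l', h']) (G t)%:E)%E.
  by apply: fineK; apply: integrable_fin_num => //; exact: iF.
have iFI : (leb R).-integrable setT (EFin \o (F \_ `[l, h])).
  by rewrite -restrict_EFin; apply: (proj1 (integrable_mkcond _ _)) => //; exact: iF.
have iGJ : (leb R).-integrable setT ((EFin \o G) \_ `[l', h']).
  by apply: (proj1 (integrable_mkcond _ _)) => //; exact: iF.
have inner u :
    (\int[leb R]_v ((EFin \o (fun w => F w.1 * G w.2)%R) \_ D) (u, v) =
     ((F \_ `[l, h]) u * \int[leb R]_(t in `[l', h']) G t)%R%:E)%E.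
  rewrite EFinM GE [X in (_ * X)%E]integral_mkcond -integralZl//.
  apply: eq_integral => v _; rewrite /patch /D in_setX /=.
  by case: (u \in _); case: (v \in _); rewrite /= ?mule0 ?mul0e.
transitivity (fine (\int[leb R]_u (((F \_ `[l, h]) u)%:E *
    (\int[leb R]_(t in `[l', h']) G t)%R%:E)%E)).
  by congr fine; apply: eq_integral => u _; rewrite -EFinM; exact: inner.
rewrite integralZr//=.
move: FE; rewrite integral_mkcond restrict_EFin => <-.
by rewrite -EFinM.
Qed.

Lemma int_face_tensors a b c E s q q' : distinct3 a b c ->
  int_face a b E (fun x => tensors_eval s x * (q.[crd x a] * q'.[crd x b])) =
  tensors_apply a b c s (mom (lo E a) (hi E a) q) (mom (lo E b) (hi E b) q') (lo E c).
Proof.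
move=> d; have [ab ca cb] : [/\ a != b, c != a & c != b].
  by move: d; rewrite /distinct3 /= !inE negb_or andbT => /andP[/andP[-> ac] bc];
    rewrite ![c == _]eq_sym.
have itens Q := integral_tensor (lo E a) (hi E a) (lo E b) (hi E b)
  (@continuous_horner R (Q a * q)) (@continuous_horner R (Q b * q')).
pose H Q (w : R * R) : R := (Q c).[lo E c] * ((Q a * q).[w.1] * (Q b * q').[w.2]).
have mD : measurable (`[lo E a, hi E a] `*` `[lo E b, hi E b] : set (R * R)).
  exact: measurableX.
have iH Q : (leb2 R).-integrable (`[lo E a, hi E a] `*` `[lo E b, hi E b])
    (EFin \o H Q).
  rewrite (_ : EFin \o _ = fun w =>
    ((Q c).[lo E c]%:E * ((Q a * q).[w.1] * (Q b * q').[w.2])%:E)%E).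
    by apply: integrableZl => //; case: (itens Q).
  by apply/funext => w.
rewrite /int_face /tensors_apply.
transitivity (\int[leb2 R]_(w in `[lo E a, hi E a] `*` `[lo E b, hi E b])
    (\sum_(Q <- s) H Q w)).
  apply: eq_Rintegral => w _; rewrite mulr_suml; apply: eq_bigr => Q _.
  rewrite (tensor_evalE _ _ d) !crd_upd !eqxx (negPf ab) (negPf ca) (negPf cb).
  by rewrite /H !hornerM /lo; ring.
elim: s => [|Q s ih].
  under eq_Rintegral do rewrite big_nil.
  by rewrite Rintegral_cst// mul0r big_nil.
under eq_Rintegral do rewrite big_cons.
rewrite RintegralD//; last first.
  rewrite (_ : EFin \o _ = fun w => (\sum_(Q <- s) (EFin \o H Q) w)%E).
    exact: integrable_sum.
  by apply/funext => w /=; rewrite sumEFin.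
rewrite ih big_cons; congr (_ + _); rewrite /H RintegralZl//; last by case: (itens Q).
have [_ ->] := itens Q; rewrite mulrC /mom.
by congr (_ * _ * _); apply: eq_Rintegral => t _; rewrite hornerM.
Qed.

(** At an end [v] of [E], one slice of a face is an edge of it and a second slice is a vertex. *)
Definition slice E b v : box R := (upd E.1 b v, upd E.2 b v).

Lemma lo_slice E b v m : lo (slice E b v) m = if m == b then v else lo E m.
Proof. exact: crd_upd. Qed.

Lemma hi_slice E b v m : hi (slice E b v) m = if m == b then v else hi E m.
Proof. exact: crd_upd. Qed.

Lemma subentity_slice E T b v : subentity E T -> lo E b < hi E b ->
  v \in [:: lo E b; hi E b] -> subentity (slice E b v) T.
Proof.
move=> ET ltE vE m; rewrite lo_slice hi_slice; case: eqP => [->|_]; last exact: ET.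
right; split=> //; have [[<- <-]|[e _]] := ET b; last by rewrite e ltxx in ltE.
by move: vE; rewrite !inE => /orP[]/eqP->; [left|right].
Qed.

End Dofs.

(** * Continuity across faces *)

Lemma size_moments1 (k n : nat) : (n <= k)%N -> n%:Z <= k%:Z - 1 + 1.
Proof. by rewrite subrK lez_nat. Qed.

(** Here and in [size_moments3], the left bound is the size left by [determining], with truncated
    subtraction, and the right one an integer degree bound; [2 <= k] reconciles them. *)
Lemma size_moments2 (k n : nat) : (2 <= k)%N ->
  (n <= k + 1 - 2)%N -> n%:Z <= k%:Z - 2 + 1.
Proof. by lia. Qed.

Lemma size_moments3 (k n : nat) : (2 <= k)%N ->
  (n <= k + 2 - 4)%N -> n%:Z <= k%:Z - 3 + 1.
Proof. by lia. Qed.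

Section Agreement.
Variables (R : realType) (k : nat) (u u' : R3 R -> 'M[R]_3) (T T' : box R).
Hypotheses (shape : Phi_shape k u) (shape' : Phi_shape k u').
Hypothesis dofs : forall E dof, Phi_dof k E dof ->
  subentity E T -> subentity E T' -> dof u = dof u'.
Implicit Types (x y : R3 R) (i j l a b c m : 'I_3) (t v z : R) (E : box R).
Implicit Types (q : {poly R}).
Notation tensor := {ffun 'I_3 -> {poly R}}.
Implicit Types (Q : tensor) (s : seq tensor).

Lemma distinct3P i j l : distinct3 i j l ->
  [/\ i != j, i != l, j != l & [/\ j != i, l != i & l != j]].
Proof.
rewrite /distinct3 /= !inE negb_or andbT => /andP[/andP[ij il] jl].
by rewrite ![_ == i]eq_sym [l == j]eq_sym ij il jl.
Qed.

Lemma distinct3_forall i j l (P : 'I_3 -> Prop) : distinct3 i j l ->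
  P i -> P j -> P l -> forall m, P m.
Proof.
move=> d Pi Pj Pl m.
have : ~~ uniq [:: m; i; j; l].
  by apply/negP => /card_uniqP us; have := max_card (mem [:: m; i; j; l]);
    rewrite us card_ord.
rewrite cons_uniq (d : uniq [:: i; j; l]) andbT negbK !inE.
by move=> /orP[/eqP->//|/orP[]/eqP->].
Qed.

Lemma Q1_horner i (n : int) q : (size q)%:Z <= n + 1 ->
  Q1 i n (fun x => q.[crd x i]).
Proof.
move=> qn; rewrite /Q1 (_ : (fun x => _) = fun x : R3 R =>
    \prod_m (if m == i then q else 1%:P).[crd x m]).
  apply: Qspace_prod => m; case: eqP => _ //.
  by rewrite size_polyC oner_eq0.
apply/funext => x; rewrite (bigD1 i)//= eqxx big1 ?mulr1// => m mi.
by rewrite (negPf mi) hornerC.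
Qed.

Lemma Q2_horner i j (n n' : int) q q' : i != j ->
  (size q)%:Z <= n + 1 -> (size q')%:Z <= n' + 1 ->
  Q2 i n j n' (fun x => q.[crd x i] * q'.[crd x j]).
Proof.
move=> ij qn qn'; rewrite /Q2 (_ : (fun x => _) = fun x : R3 R =>
    \prod_m (if m == i then q else if m == j then q' else 1%:P).[crd x m]).
  apply: Qspace_prod => m; case: eqP => _ //; case: eqP => _ //.
  by rewrite size_polyC oner_eq0.
apply/funext => x; have ji : j != i by rewrite eq_sym.
rewrite (bigD1 i)//= eqxx (bigD1 j ji)/= (negPf ji) eqxx big1 ?mulr1// => m /andP[mi mj].
by rewrite (negPf mi) (negPf mj) hornerC.
Qed.

Definition tensors_partials (D : seq 'I_3) s :=
  foldr (fun a => map (tensor_deriv a)) s D.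

Lemma partials_tensors D s :
  partials D (tensors_eval s) = tensors_eval (tensors_partials D s).
Proof. by elim: D => //= a D ->; rewrite partial_tensors_eval. Qed.

(** One decomposition serves the function and all its derivatives, as differentiation does not raise
    degrees. *)
Lemma Q3_tensors i j l (n n' n'' : int) f : distinct3 i j l ->
  Q3 i n j n' l n'' f -> exists2 s, f = tensors_eval s &
  forall D Q, Q \in tensors_partials D s -> [/\ (size (Q i))%:Z <= n + 1,
    (size (Q j))%:Z <= n' + 1 & (size (Q l))%:Z <= n'' + 1].
Proof.
move=> /distinct3P[ij il jl [ji li lj]] /Qspace_tensors[s ds ->].
exists s => // D Q Qs.
have {}ds : degrees_le (fun m => if m == i then n else if m == j then n' else n'')
    (tensors_partials D s).
  by elim: D {Qs} => //= a D; exact: degrees_le_deriv.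
split; first by have := ds Q i Qs; rewrite eqxx.
- by have := ds Q j Qs; rewrite (negPf ji) eqxx.
- by have := ds Q l Qs; rewrite (negPf li) (negPf lj).
Qed.

Lemma entry_sym i j : entry u i j = entry u j i.
Proof. by apply/funext => x; case: shape => + _ _; apply. Qed.

Lemma entry_sym' i j : entry u' i j = entry u' j i.
Proof. by apply/funext => x; case: shape' => + _ _; apply. Qed.

Variable E : box R.
Hypotheses (ET : subentity E T) (ET' : subentity E T').

Lemma dofs_slice a v dof : lo E a < hi E a -> v \in [:: lo E a; hi E a] ->
  Phi_dof k (slice E a v) dof -> dof u = dof u'.
Proof. by move=> ltE vE /dofs; apply; exact: subentity_slice. Qed.

Lemma dofs_slice2 a b v w dof : a != b -> lo E a < hi E a -> lo E b < hi E b ->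
  v \in [:: lo E a; hi E a] -> w \in [:: lo E b; hi E b] ->
  Phi_dof k (slice (slice E a v) b w) dof -> dof u = dof u'.
Proof.
rewrite eq_sym => /negPf ba ltEa ltEb vE wE /dofs; apply;
  by apply: subentity_slice; rewrite ?lo_slice ?hi_slice ?ba//;
    exact: subentity_slice.
Qed.

Lemma edge_slice a b c v : distinct3 a b c -> lo E a < hi E a ->
  lo E c = hi E c -> edge_along a (slice E b v).
Proof.
move=> d aE cE; have [ab ac bc [ba ca cb]] := distinct3P d.
apply: (distinct3_forall d); rewrite !inE !lo_slice !hi_slice ?eqxx;
  by rewrite ?(negPf ab) ?(negPf ba) ?(negPf ca) ?(negPf cb).
Qed.

Lemma face_box a b c : distinct3 a b c -> lo E a < hi E a -> lo E b < hi E b ->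
  lo E c = hi E c -> face_along a b E.
Proof.
move=> d aE bE cE; have [ab ac bc [ba ca cb]] := distinct3P d.
by apply: (distinct3_forall d); rewrite !inE ?eqxx ?orbT ?(negPf ca) ?(negPf cb).
Qed.

Lemma vertex_slice a b c v w : distinct3 a b c -> lo E c = hi E c ->
  is_vertex (slice (slice E a v) b w).
Proof.
move=> d cE; have [ab ac bc [ba ca cb]] := distinct3P d.
apply: (distinct3_forall d); rewrite !lo_slice !hi_slice ?eqxx //;
  by rewrite ?(negPf ab) ?(negPf ca) ?(negPf cb).
Qed.

Lemma int_edge_slice a b c v s q : distinct3 a b c ->
  int_edge a (slice E b v) (fun x => tensors_eval s x * q.[crd x a]) =
  tensors_apply a b c s (mom (lo E a) (hi E a) q) (fun p => p.[v]) (lo E c).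
Proof.
move=> d; have [ab ac bc [ba ca cb]] := distinct3P d.
by rewrite (int_edge_tensors _ _ _ d) !lo_slice hi_slice eqxx (negPf ab) (negPf cb).
Qed.

Lemma eval_vertex_slice a b c v w s : distinct3 a b c ->
  tensors_eval s (slice (slice E a v) b w).1 =
  tensors_apply a b c s (fun p => p.[v]) (fun p => p.[w]) (lo E c).
Proof.
move=> d; have [ab ac bc [ba ca cb]] := distinct3P d.
by rewrite (tensors_apply_eval _ _ d) /= !crd_upd !eqxx (negPf ab) (negPf cb) (negPf ca).
Qed.

(** Moments determine the dependence on x_i, Hermite data and moments the one on x_j. The edges
    parallel to x_i supply the end values in x_j and, through the derivatives d_j and d_j d_l, the
    end slopes. *)
Lemma diag_agree i j l (D : seq 'I_3) : (2 <= k)%N -> distinct3 i j l ->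
  lo E l = hi E l -> lo E i < hi E i -> lo E j < hi E j ->
  D \in [:: [::]; [:: l]] ->
  forall y, crd y l = lo E l ->
    partials D (entry u i i) y = partials D (entry u' i i) y.
Proof.
move=> k2 d lE iE jE DE; have [_ _ _ [ji _ _]] := distinct3P d.
have [[_ sh _] [_ sh' _]] := (shape, shape').
have [s us sz] := Q3_tensors d (sh _ _ _ d).
have [s' us' sz'] := Q3_tensors d (sh' _ _ _ d).
rewrite us us' !partials_tensors.
apply: (tensors_agree d (moments_determining k iE)
  (Hermite_moments_determining (k + 2) jE)).
  by move=> Q; rewrite mem_cat => /orP[/sz|/sz'] [+ + _];
    rewrite subrK -!PoszD !lez_nat -addnA => -> ->.
have edge q v (D' : seq 'I_3) : (size q <= k)%N -> v \in [:: lo E j; hi E j] ->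
    D' \in [:: [::]; [:: j]; [:: l]; [:: j; l]] ->
    tensors_apply i j l (tensors_partials D' s) (mom (lo E i) (hi E i) q)
      (fun p => p.[v]) (lo E l) =
    tensors_apply i j l (tensors_partials D' s') (mom (lo E i) (hi E i) q)
      (fun p => p.[v]) (lo E l).
  move=> qk vE D'E; have qQ : Q1 i (k%:Z - 1) (fun x => q.[crd x i]).
    by apply: Q1_horner; exact: size_moments1.
  have := dofs_slice jE vE (Dof_diag_edge d (edge_slice v d iE lE) D'E qQ).
  by rewrite us us' !partials_tensors !(int_edge_slice _ _ _ d).
move=> _ mu [q qk ->] [[[v vE ->]|[v vE ->]]|[q' qk' ->]].
- apply: edge => //; move: DE; rewrite !inE.
  by move=> /orP[]/eqP->; rewrite eqxx ?orbT.
- have := edge q v (j :: D) qk vE; rewrite /= !tensors_apply_deriv//; apply.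
  by move: DE; rewrite !inE => /orP[]/eqP->; rewrite !eqxx ?orbT.
- have qQ : Q2 i (k%:Z - 1) j (k%:Z - 3) (fun x => q.[crd x i] * q'.[crd x j]).
    by apply: Q2_horner; [rewrite eq_sym|exact: size_moments1|exact: size_moments3].
  have := dofs (Dof_diag_face d (face_box d iE jE lE) DE qQ) ET ET'.
  by rewrite us us' !partials_tensors !(int_face_tensors _ _ _ _ d).
Qed.

(** End values and moments in both variables: their four combinations are the degrees of freedom at
    the vertices, on the two kinds of edges and on the face. *)
Lemma off_agree_face i j l (D : seq 'I_3) : (2 <= k)%N -> distinct3 i j l ->
  (i < j)%N -> lo E l = hi E l -> lo E i < hi E i -> lo E j < hi E j ->
  D \in [:: [::]; [:: l]] ->
  forall y, crd y l = lo E l ->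
    partials D (entry u i j) y = partials D (entry u' i j) y.
Proof.
move=> k2 d ltij lE iE jE DE; have [ij il jl [ji li lj]] := distinct3P d.
have d' : distinct3 j i l by rewrite /distinct3 /= !inE negb_or ji jl il.
have [[_ _ sh] [_ _ sh']] := (shape, shape').
have [s us sz] := Q3_tensors d (sh _ _ _ d).
have [s' us' sz'] := Q3_tensors d (sh' _ _ _ d).
rewrite us us' !partials_tensors.
apply: (tensors_agree d (values_moments_determining (k + 1) iE)
  (values_moments_determining (k + 1) jE)).
  move=> Q; rewrite mem_cat => /orP[/sz|/sz'] [];
    by rewrite -PoszD !lez_nat => -> ->.
have qQ m q : (size q <= k + 1 - 2)%N -> Q1 m (k%:Z - 2) (fun x => q.[crd x m]).
  by move=> qk; apply: Q1_horner; exact: size_moments2.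
move=> _ _ [[v vE ->]|[q qk ->]] [[w wE ->]|[q' qk' ->]].
- have := dofs_slice2 ij iE jE vE wE (Dof_off_vertex k d ltij (vertex_slice v w d lE) DE).
  by rewrite us us' !partials_tensors !(eval_vertex_slice _ _ _ d).
- have jij : j \in [:: i; j] by rewrite !inE eqxx orbT.
  have := dofs_slice iE vE
    (Dof_off_edge d ltij jij (edge_slice v d' jE lE) DE (qQ _ _ qk')).
  rewrite us us' !partials_tensors !(int_edge_slice _ _ _ d').
  by rewrite !(tensors_applyC j i).
- have iij : i \in [:: i; j] by rewrite mem_head.
  have := dofs_slice jE wE
    (Dof_off_edge d ltij iij (edge_slice w d iE lE) DE (qQ _ _ qk)).
  by rewrite us us' !partials_tensors !(int_edge_slice _ _ _ d).
- have qq : Q2 i (k%:Z - 2) j (k%:Z - 2) (fun x => q.[crd x i] * q'.[crd x j]).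
    by apply: Q2_horner => //; exact: size_moments2.
  have := dofs (Dof_off_face d ltij (face_box d iE jE lE) DE qq) ET ET'.
  by rewrite us us' !partials_tensors !(int_face_tensors _ _ _ _ d).
Qed.

(** Here x_l is tangential to the face, so the degrees of freedom of d_l at vertices and on edges
    act as end slopes in x_l, where the degree is k+1. *)
Lemma off_agree_normal i j l n r : (2 <= k)%N -> distinct3 i j l ->
  (i < j)%N -> n \in [:: i; j] -> distinct3 n l r ->
  lo E r = hi E r -> lo E n < hi E n -> lo E l < hi E l ->
  forall y, crd y r = lo E r -> entry u i j y = entry u' i j y.
Proof.
move=> k2 d ltij nij dn rE nE lE; have [nl nr lr [ln rn rl]] := distinct3P dn.
have dn' : distinct3 l n r by rewrite /distinct3 /= !inE negb_or ln lr nr.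
have [[_ _ sh] [_ _ sh']] := (shape, shape').
have [s us sz] := Q3_tensors d (sh _ _ _ d).
have [s' us' sz'] := Q3_tensors d (sh' _ _ _ d).
rewrite us us'.
apply: (tensors_agree dn (values_moments_determining (k + 1) nE)
  (Hermite_moments_determining (k + 2) lE)).
  move=> Q; rewrite mem_cat => /orP[/(sz [::])|/(sz' [::])] [];
    rewrite -!PoszD !lez_nat -addnA => Qi Qj ->; split=> //;
    by move: nij; rewrite !inE => /orP[]/eqP->.
have qQ m q : (size q <= k + 1 - 2)%N -> Q1 m (k%:Z - 2) (fun x => q.[crd x m]).
  by move=> qk; apply: Q1_horner; exact: size_moments2.
have D0 : [::] \in [:: [::]; [:: l]] by rewrite mem_head.
have Dl : [:: l] \in [:: [::]; [:: l]] by rewrite !inE eqxx orbT.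
move=> _ _ [[v vE ->]|[q qk ->]] [[[w wE ->]|[w wE ->]]|[q' qk' ->]].
- have := dofs_slice2 nl nE lE vE wE
    (Dof_off_vertex k d ltij (vertex_slice v w dn rE) D0).
  by rewrite us us' !partials_tensors !(eval_vertex_slice _ _ _ dn).
- have := dofs_slice2 nl nE lE vE wE
    (Dof_off_vertex k d ltij (vertex_slice v w dn rE) Dl).
  rewrite us us' !partials_tensors !(eval_vertex_slice _ _ _ dn).
  by rewrite /= !tensors_apply_deriv.
- have qQ' : Q1 l (k%:Z - 3) (fun x => q'.[crd x l]).
    by apply: Q1_horner; exact: size_moments3.
  have := dofs_slice nE vE (Dof_off_edge_normal d ltij (edge_slice v dn' lE rE) qQ').
  rewrite us us' !(int_edge_slice _ _ _ dn').
  by rewrite !(tensors_applyC l n).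
- have := dofs_slice lE wE
    (Dof_off_edge d ltij nij (edge_slice w dn nE rE) D0 (qQ _ _ qk)).
  by rewrite us us' !partials_tensors !(int_edge_slice _ _ _ dn).
- have := dofs_slice lE wE
    (Dof_off_edge d ltij nij (edge_slice w dn nE rE) Dl (qQ _ _ qk)).
  rewrite us us' !partials_tensors !(int_edge_slice _ _ _ dn).
  by rewrite /= !tensors_apply_deriv.
- have qq : Q2 n (k%:Z - 2) l (k%:Z - 3) (fun x => q.[crd x n] * q'.[crd x l]).
    by apply: Q2_horner; [|exact: size_moments2|exact: size_moments3].
  have := dofs (Dof_off_face_normal d ltij nij (face_box dn nE lE rE) qq) ET ET'.
  by rewrite us us' !(int_face_tensors _ _ _ _ dn).
Qed.

Lemma third_direction a b : a != b -> exists c, distinct3 a b c.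
Proof.
move: a b; apply: ord3P; apply: ord3P => //= _;
  by [exists 0|exists 1|exists 2].
Qed.

Lemma entry_agree a b c : (2 <= k)%N -> lo E c = hi E c ->
  (forall m, m != c -> lo E m < hi E m) -> (c != a) || (c != b) ->
  forall y, crd y c = lo E c -> entry u a b y = entry u' a b y.
Proof.
(* Off-diagonal degrees of freedom are given for i < j; symmetry of the field covers the rest. *)
move=> k2 cE ltE; wlog leab : a b / (a <= b)%N => [H|].
  case: (leqP a b) => [|/ltnW] ab cab; first exact: H.
  by rewrite (entry_sym a) (entry_sym' a); apply: H => //; rewrite orbC.
have [<-|ab] := eqVneq a b.
  rewrite orbb => ca; have [j d] := third_direction ca.
  have [_ cj aj [ac jc ja]] := distinct3P d.
  have d' : distinct3 a j c by rewrite /distinct3 /= !inE negb_or aj ac jc.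
  by apply: (diag_agree (D := [::]) k2 d' cE); rewrite ?ltE ?mem_head.
have ltab : (a < b)%N by rewrite ltn_neqAle leab andbT.
have [l d] := third_direction ab.
have [_ al bl [ba la lb]] := distinct3P d.
have [clE _|cl cab] := eqVneq c l.
  rewrite -clE in d bl al la lb *.
  by apply: (off_agree_face (D := [::]) k2 d ltab cE); rewrite ?mem_head ?ltE// eq_sym.
have [caE|ca] := eqVneq c a.
  rewrite caE in cE ltE *; apply: (off_agree_normal (n := b) k2 d) => //.
  - by rewrite !inE eqxx orbT.
  - by rewrite /distinct3 /= !inE negb_or bl ba la.
  - exact: ltE.
  - exact: ltE.
have cbE : c = b.
  have : c \in [:: a; b; l].
    by apply: (distinct3_forall (P := fun m => m \in [:: a; b; l]) d);
      rewrite !inE eqxx ?orbT.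
  by rewrite !inE (negPf ca) (negPf cl) orbF => /eqP.
rewrite cbE in cE ltE *; apply: (off_agree_normal (n := a) k2 d) => //.
- by rewrite mem_head.
- by rewrite /distinct3 /= !inE negb_or al ab lb.
- exact: ltE.
- exact: ltE.
Qed.

Lemma partial_entry_agree a b c : (2 <= k)%N -> lo E c = hi E c ->
  (forall m, m != c -> lo E m < hi E m) -> c != a -> c != b ->
  forall y, crd y c = lo E c ->
    partial c (entry u a b) y = partial c (entry u' a b) y.
Proof.
move=> k2 cE ltE; wlog leab : a b / (a <= b)%N => [H|].
  case: (leqP a b) => [|/ltnW] ab ca cb; first exact: H.
  by rewrite (entry_sym a) (entry_sym' a); apply: H.
have cD : [:: c] \in [:: [::]; [:: c]] by rewrite !inE eqxx orbT.
have [<- ca _|ab ca cb] := eqVneq a b.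
  have [j d] := third_direction ca; have [_ cj aj [ac jc ja]] := distinct3P d.
  have d' : distinct3 a j c by rewrite /distinct3 /= !inE negb_or aj ac jc.
  by apply: (diag_agree k2 d' cE) cD; rewrite ltE.
have d : distinct3 a b c.
  by rewrite /distinct3 /= !inE negb_or ab ![_ == c]eq_sym ca cb.
have ltab : (a < b)%N by rewrite ltn_neqAle leab andbT.
by apply: (off_agree_face k2 d ltab cE) cD; rewrite ltE// eq_sym.
Qed.

End Agreement.

(** * Conformity *)

Section Conformity.
Variables (R : realType) (Omega : set (R3 R)) (Th : seq (box R)) (k : nat).
Variables (u : R3 R -> 'M[R]_3) (p : box R -> R3 R -> 'M[R]_3).
Hypotheses (oO : open Omega) (mesh : cuboid_mesh Omega Th) (k2 : (2 <= k)%N).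
Hypothesis mu : forall i j, measurable_fun Omega (entry u i j).
Hypothesis shape : {in Th, forall T, Phi_shape k (p T)}.
Hypothesis u_eq : {in Th, forall T, {ae leb3 R, forall x, box_set T x -> u x = p T x}}.
Hypothesis dofs : forall E dof, Phi_dof k E dof ->
  {in Th &, forall T T', subentity E T -> subentity E T' -> dof (p T) = dof (p T')}.
Implicit Types (x y : R3 R) (a b i j m r s : 'I_3) (f g phi : R3 R -> R).
Implicit Types (T E : box R).

Definition support f : set (R3 R) := closure [set x | f x != 0].

(** Off its support a function vanishes near the point, and so does its derivative. *)
Lemma support_partial f a : support (partial a f) `<=` support f.
Proof.
rewrite /support [X in _ `<=` X](closure_id _).1; last exact: closed_closure.
apply: closureS => x /= fx.
apply: contrapT => /= xf; move/eqP: fx; apply.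
have xf0 : \near x, f x = 0.
  have : (~` [set x | f x != 0])° x by rewrite interiorC.
  by apply: filterS => y /= /negP; rewrite negbK => /eqP.
by rewrite /partial (near_eq_derive (g := cst 0)) ?derive_cst.
Qed.

Lemma support_neq0 f x : f x != 0 -> support f x.
Proof. by move=> fx; apply: subset_closure. Qed.

(** The default 0 makes this a polynomial for every box, so regularity holds without membership in
    the mesh. *)
Definition component i j T : R3 R -> R :=
  if T \in Th then entry (p T) i j else fun=> 0.

Lemma component_tensors i j T : exists S : seq {ffun 'I_3 -> {poly R}},
  component i j T = tensors_eval S.
Proof.
rewrite /component; case: (boolP (T \in Th)) => [/shape sh|_]; last first.
  by exists [::]; apply/funext => x; rewrite /tensors_eval big_nil.
have [_ sd so] := sh; have [<-|ij] := eqVneq i j.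
  have [j' ij'] : exists j', i != j'.
    by elim/ord3P: i {sd so}; [exists 1|exists 0|exists 0].
  have [l d] := third_direction ij'.
  by have [s -> _] := Q3_tensors d (sd _ _ _ d); exists s.
have [l d] := third_direction ij.
by have [s -> _] := Q3_tensors d (so _ _ _ d); exists s.
Qed.

Lemma component_C1 i j T a : C1_along a (component i j T).
Proof. by have [s ->] := component_tensors i j T; exact: C1_tensors_eval. Qed.

Lemma component_partial_C1 i j T a b : C1_along a (partial b (component i j T)).
Proof.
have [s ->] := component_tensors i j T.
by rewrite partial_tensors_eval; exact: C1_tensors_eval.
Qed.

Lemma component_continuous i j T : continuous (component i j T).
Proof. by have [s ->] := component_tensors i j T; exact: continuous_tensors_eval. Qed.

Lemma component_partial2_continuous i j T a b :
  continuous (partial a (partial b (component i j T))).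
Proof. by have [_ _] := component_partial_C1 i j T a b. Qed.

Lemma conforming_component i j a : (a != i) || (a != j) ->
  conforming Th a (component i j).
Proof.
move=> aij T T' TTh T'Th E ET ET' aE ltE y ya; rewrite /component TTh T'Th.
apply: (entry_agree (shape TTh) (shape T'Th) _ ET ET' k2 aE ltE aij ya).
by move=> E' dof D; exact: (dofs D).
Qed.

(* A tangential derivative inherits the continuity of the field itself; only
   the derivative normal to the face uses the normal degrees of freedom. *)
Lemma conforming_partial_component i j a b : a != j -> b != i ->
  conforming Th a (fun T => partial b (component i j T)).
Proof.
move=> aj bi T T' TTh T'Th E ET ET' aE ltE y ya.
have [ab|ab] := eqVneq a b; last first.
  rewrite !partial_derive1; congr (derive1 _ _); apply/funext => t.
  have aij : (a != i) || (a != j) by rewrite aj orbT.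
  apply: (conforming_component aij TTh T'Th ET ET') => //.
  by rewrite crd_upd (negPf ab).
rewrite -ab /component TTh T'Th; rewrite -ab in bi.
apply: (partial_entry_agree (shape TTh) (shape T'Th) _ ET ET' k2 aE ltE bi aj ya).
by move=> E' dof D; exact: (dofs D).
Qed.

Definition second_partial a b i j : R3 R -> R :=
  piecewise Th (fun T => partial a (partial b (component i j T))).

Lemma weak_second_partial i j a b phi : a != j -> b != i ->
  test_function Omega phi ->
  \int[leb3 R]_x (piecewise Th (component i j) x * partial b (partial a phi) x) =
  \int[leb3 R]_x (second_partial a b i j x * phi x).
Proof.
move=> aj bi [sphi _ suppO].
have supp0 y : phi y != 0 -> Omega y by move=> /support_neq0 /suppO.
have supp1 y : partial a phi y != 0 -> Omega y.
  by move=> /support_neq0 /support_partial /suppO.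
have c1 T := component_C1 i j T b.
have c2 T := component_partial_C1 i j T a b.
have cphi := smooth_C1 b (smooth_partial a sphi).
have conf : conforming Th b (component i j) by apply: conforming_component; rewrite bi.
rewrite (piecewise_by_parts oO mesh conf c1 cphi supp1).
rewrite (piecewise_by_parts oO mesh (conforming_partial_component aj bi) c2
  (smooth_C1 a sphi) supp0).
by rewrite opprK.
Qed.

Local Instance ae_leb3_filter : Filter (nbhs (almost_everywhere (leb3 R))).
Proof. exact: ae_filter_ringOfSetsType. Qed.

Lemma ae_all_seq (I : eqType) (S : seq I) (Q : I -> R3 R -> Prop) :
  {in S, forall n, {ae leb3 R, forall x, Q n x}} ->
  {ae leb3 R, forall x, {in S, forall n, Q n x}}.
Proof.
elim: S => [_|i S ih H]; first by apply: aeW => x n.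
have Hi := H i (mem_head _ _).
have Hs : {ae leb3 R, forall x, {in S, forall n, Q n x}}.
  by apply: ih => j js; apply: H; rewrite inE js orbT.
apply: filterS2 Hi Hs => x Qi Qs j; rewrite inE => /orP[/eqP->//|]; exact: Qs.
Qed.

Lemma ae_crd_neq a (c : R) : {ae leb3 R, forall x, crd x a != c}.
Proof.
pose N : set (R3 R) := [set x | crd x a = c].
suff [mN N0] : measurable N /\ leb3 R N = 0%E.
  exists N; split=> // x /=; rewrite /N /=; apply: contra_notP => /eqP //.
have mc : measurable [set c] by [].
have set0' : leb R [set c] = 0%E by exact: lebesgue_measure_set1.
have null1 (A : set R) : measurable A -> leb2 R (A `*` [set c]) = 0%E.
  by move=> mA; rewrite product_measure1E//; exact: (etrans (congr1 _ set0') (mule0 _)).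
have null2 : leb2 R ([set c] `*` setT) = 0%E.
  rewrite product_measure1E//.
  exact: (etrans (congr1 (fun z => z * leb R setT)%E set0') (mul0e _)).
have null3 (A : set (R * R)) : measurable A -> leb2 R A = 0%E ->
    measurable (A `*` [set: R]) /\ leb3 R (A `*` [set: R]) = 0%E.
  move=> mA A0; split; first exact: measurableX.
  rewrite product_measure1E//.
  exact: (etrans (congr1 (fun z => z * leb R setT)%E A0) (mul0e _)).
elim/ord3P: a @N => N.
- have -> : N = ([set c] `*` setT) `*` setT.
    by apply/seteqP; split=> [x xc|x [[]]//]; do 2 split.
  by apply: null3 => //; exact: measurableX.
- have -> : N = (setT `*` [set c]) `*` setT.
    by apply/seteqP; split=> [x xc|x [[]]//]; do 2 split.
  by apply: null3; [exact: measurableX|exact: null1].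
- have -> : N = setT `*` [set c].
    by apply/seteqP; split=> [x xc|x []//]; split.
  split; first exact: measurableX.
  rewrite product_measure1E//.
  exact: (etrans (congr1 _ set0') (mule0 _)).
Qed.

(** The planes carrying the faces of the finitely many cells are null sets. *)
Lemma ae_cell : {ae leb3 R, forall x, Omega x ->
  exists2 T, T \in Th & box_inner T x /\ u x = p T x}.
Proof.
have H1 : {ae leb3 R, forall x, {in Th, forall T, box_set T x -> u x = p T x}}.
  exact: ae_all_seq.
have H2 : {ae leb3 R, forall x, {in Th, forall T,
    {in enum 'I_3, forall a, crd x a != lo T a}}}.
  by apply: ae_all_seq => T _; apply: ae_all_seq => a _; exact: ae_crd_neq.
have H3 : {ae leb3 R, forall x, {in Th, forall T,
    {in enum 'I_3, forall a, crd x a != hi T a}}}.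
  by apply: ae_all_seq => T _; apply: ae_all_seq => a _; exact: ae_crd_neq.
apply: filterS2 H1 (filterI H2 H3) => x ux [xlo xhi] Ox.
have [_ cov _ _] := mesh.
have : closure Omega x by exact: subset_closure.
rewrite cov => -[T /= TTh xT]; exists T => //; split; last exact: ux.
move=> a; have /andP[la ha] := xT a.
rewrite !lt_neqAle la ha !andbT eq_sym xlo ?xhi//; by rewrite mem_enum.
Qed.

Lemma piecewise_cell P T x : T \in Th -> box_inner T x -> piecewise Th P x = P T x.
Proof.
move=> TTh xT; rewrite /piecewise (bigD1_seq T) ?mem_undup ?undup_uniq//=.
rewrite indicE mem_set// mul1r big_seq_cond big1 ?addr0// => T'.
rewrite mem_undup => /andP[T'Th T'T]; rewrite indicE memNset ?mul0r// => xT'.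
have [_ _ dis _] := mesh; have := dis _ _ T'Th TTh T'T.
move=> TT'0; have : set0 x by rewrite -TT'0.
by [].
Qed.

Lemma ae_piecewise i j : {ae leb3 R, forall x, Omega x ->
  entry u i j x = piecewise Th (component i j) x}.
Proof.
apply: filterS ae_cell => x H /H[T TTh [xT ux]].
by rewrite (piecewise_cell _ TTh xT) /component TTh /entry ux.
Qed.

Lemma measurable_Omega : measurable Omega.
Proof. exact: open_measurable3. Qed.

Lemma tame_component i j : tame (piecewise Th (component i j)).
Proof. by apply: tame_piecewise => T; exact: component_continuous. Qed.

Lemma tame_second_partial a b i j : tame (second_partial a b i j).
Proof. by apply: tame_piecewise => T; exact: component_partial2_continuous. Qed.

Lemma tame_L2 f : tame f -> L2 Omega f.
Proof.
move=> tf; have mO := measurable_Omega.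
split; first by apply: measurable_funTS; case: tf.
apply: (integrableS (E := setT)) => //.
by apply: tame_integrable (tameM tf tf).
Qed.

Lemma L2_u : L2_mx Omega u.
Proof.
move=> i j; have mO := measurable_Omega; split; first exact: mu.
have [_ /integrableP[mpw pwoo]] := tame_L2 (tame_component i j).
have mu2 : measurable_fun Omega (fun x => (entry u i j x ^+ 2)%:E).
  by apply/measurable_EFinP; apply: measurable_funX; exact: mu.
apply/integrableP; split=> //.
apply: le_lt_trans pwoo; rewrite le_eqVlt; apply/orP; left; apply/eqP.
apply: ae_eq_integral => //.
- exact: measurableT_comp.
- exact: measurableT_comp.
- by apply: filterS (ae_piecewise i j) => x H Ox; rewrite /= H.
Qed.

Lemma sym_u : {ae leb3 R, forall x, Omega x -> (u x)^T = u x}.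
Proof.
apply: filterS ae_cell => x H /H[T /shape[sym _ _] [_ ->]].
by apply/matrixP => i j; rewrite mxE.
Qed.

Lemma regular_distr_component i j psi : continuous psi ->
  (forall x, psi x != 0 -> Omega x) ->
  regular_distr Omega (entry u i j) psi =
  \int[leb3 R]_x (piecewise Th (component i j) x * psi x).
Proof.
move=> cpsi psiO; have mO := measurable_Omega.
have mpsi := continuous_measurable3 cpsi.
have [mpw _] := tame_component i j.
rewrite /regular_distr.
transitivity (\int[leb3 R]_(x in Omega) (piecewise Th (component i j) x * psi x)).
  rewrite /Rintegral; congr fine; apply: ae_eq_integral => //.
  - apply/measurable_EFinP.
    by apply: measurable_funM; [exact: mu|exact: measurable_funTS].
  - by apply/measurable_EFinP; apply: measurable_funM; exact: measurable_funTS.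
  - by apply: filterS (ae_piecewise i j) => x H Ox; rewrite H.
rewrite Rintegral_mkcond; apply: eq_Rintegral => x _; rewrite /patch.
case: ifPn => // /negP xO; have [->|/psiO Ox] := eqVneq (psi x) 0.
  by rewrite mulr0.
by case: xO; rewrite inE.
Qed.

(** The formula of curl curl^T with derivatives taken cell by cell. In each term the inner direction
    and the row are the two indices other than [m], the outer direction and the column the two other
    than [i]. *)
Definition curlcurl_u x : 'M[R]_3 := \matrix_(m, i)
  (second_partial (i + 1) (m + 1) (m + 2) (i + 2) x
   - second_partial (i + 1) (m + 2) (m + 1) (i + 2) x
   - (second_partial (i + 2) (m + 1) (m + 2) (i + 1) x
   - second_partial (i + 2) (m + 2) (m + 1) (i + 1) x)).

Lemma tame_curlcurl_u m i : tame (entry curlcurl_u m i).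
Proof.
have t2 := tame_second_partial.
rewrite (_ : entry _ _ _ = fun x =>
   second_partial (i + 1) (m + 1) (m + 2) (i + 2) x
   - second_partial (i + 1) (m + 2) (m + 1) (i + 2) x
   - (second_partial (i + 2) (m + 1) (m + 2) (i + 1) x
   - second_partial (i + 2) (m + 2) (m + 1) (i + 1) x)).
  exact: (tameB (tameB (t2 _ _ _ _) (t2 _ _ _ _)) (tameB (t2 _ _ _ _) (t2 _ _ _ _))).
by apply/funext => x; rewrite /entry mxE.
Qed.

Lemma weak_curlcurl m i phi : test_function Omega phi ->
  curl (curlT (regular_mx Omega u)) m i phi = regular_mx Omega curlcurl_u m i phi.
Proof.
move=> tphi; have [sphi _ suppO] := tphi.
have I1 (n : 'I_3) : n + 1 != n + 2 by elim/ord3P: n.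
have I2 (n : 'I_3) : n + 2 != n + 1 by elim/ord3P: n.
have supp0 y : phi y != 0 -> Omega y by move=> /support_neq0 /suppO.
have cphi := smooth_continuous sphi.
pose A a b r s := \int[leb3 R]_x (second_partial a b r s x * phi x).
have dE a b r s : a != s -> b != r ->
    regular_distr Omega (entry u r s) (partial b (partial a phi)) = A a b r s.
  move=> as_ br; rewrite regular_distr_component ?weak_second_partial//.
    by apply: smooth_continuous; do 2 apply: smooth_partial.
  by move=> x /support_neq0 /support_partial /support_partial /suppO.
have tA a b r s : tame (fun x => second_partial a b r s x * phi x).
  under eq_fun do rewrite /second_partial piecewiseMr.
  apply: tame_piecewise => T x; apply: cvgM; last exact: cphi.
  exact: component_partial2_continuous.
transitivity (A (i + 1) (m + 1) (m + 2) (i + 2) - A (i + 1) (m + 2) (m + 1) (i + 2)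
    - (A (i + 2) (m + 1) (m + 2) (i + 1) - A (i + 2) (m + 2) (m + 1) (i + 1))).
  (* Each [ddistr] brings a sign, and the two cancel in every term. *)
  rewrite /curlT /curl /regular_mx !mxE /ddistr !dE//.
  by move: (A _ _ _ _) (A _ _ _ _) (A _ _ _ _) (A _ _ _ _) => *; ring.
have B f1 f2 f3 f4 : tame f1 -> tame f2 -> tame f3 -> tame f4 ->
    \int[leb3 R]_x f1 x - \int[leb3 R]_x f2 x
      - (\int[leb3 R]_x f3 x - \int[leb3 R]_x f4 x) =
    \int[leb3 R]_x (f1 x - f2 x - (f3 x - f4 x)).
  move=> t1 t2 t3 t4; rewrite -(Rintegral_tameB t1 t2) -(Rintegral_tameB t3 t4).
  by rewrite (Rintegral_tameB (tameB t1 t2) (tameB t3 t4)).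
rewrite /A (B _ _ _ _ (tA (i + 1) (m + 1) (m + 2) (i + 2))
  (tA (i + 1) (m + 2) (m + 1) (i + 2)) (tA (i + 2) (m + 1) (m + 2) (i + 1))
  (tA (i + 2) (m + 2) (m + 1) (i + 1))) {dE tA B}.
rewrite mxE /regular_distr [RHS]Rintegral_mkcond.
apply: eq_Rintegral => x _; rewrite /patch /entry mxE.
move: (second_partial _ _ _ _ x) (second_partial _ _ _ _ x)
  (second_partial _ _ _ _ x) (second_partial _ _ _ _ x) => *.
case: ifPn => [_|/negP xO]; first by rewrite !mulrBl.
have [->|/supp0 Ox] := eqVneq (phi x) 0; first by rewrite !mulr0 !subr0.
by case: xO; rewrite inE.
Qed.

End Conformity.

Theorem proposition4p3 (R : realType) (Omega : set (R3 R)) (Th : seq (box R))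
    (k : nat) (dom_Omega : domain Omega) (contr_Omega : contractible Omega)
    (lip_Omega : lipschitz_boundary Omega) (mesh_Th : cuboid_mesh Omega Th)
    (k_ge3 : (3 <= k)%N) :
  Phi_space k Omega Th `<=` Hcurlcurl Omega.
Proof.
move=> u [mu [p [shape u_eq dofs]]]; have [_ oO _] := dom_Omega.
have k2 : (2 <= k)%N by exact: ltnW.
split; first by split; [exact: (L2_u oO mesh_Th mu shape u_eq)
                       |exact: (sym_u mesh_Th shape u_eq)].
exists (curlcurl_u Th p).
  by move=> i j; apply: (tame_L2 oO); exact: (tame_curlcurl_u shape).
move=> i j phi tphi; exact: (weak_curlcurl oO mesh_Th k2 mu shape u_eq dofs).
Qed.
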